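(* In the setting described in the context, a complete set of representatives of the indecomposable elements of $\mathcal{O}_K^+$ modulo multiplication by totally positive units is given by \[ 1,\qquad \rho,\qquad \gamma_j\ (1\le j\le 6n+1). \] Hence $\iota(K)=6n+3$, and \[ \frac{\log\Delta_K}{8w}\le\iota(K)\le\frac{\log\Delta_K}{8w}+1,\qquad w:=\log\Big(\tfrac{1+\sqrt5}{2}\Big), \] where $\Delta_K$ is the discriminant of $K$.
   Context: For integers $m\ge0$ define integers $x_m,y_m$ by $\frac{x_m+y_m\sqrt5}{2}=\big(\frac{1+\sqrt5}{2}\big)^m$. Let $n\ge0$ be an integer such that $p:=y_{12n+3}^2-1$ and $r:=x_{12n+3}^2-1$ are squarefree, and let $K=\mathbb{Q}(\sqrt5,\sqrt p)$ (note $r=5p$, so $\sqrt r\in K$). Write $X=x_{12n+3}$, $Y=y_{12n+3}$, and $[a,b,c,d]:=a+b\sqrt5+c\sqrt p+d\sqrt r$. Define $\rho:=[\frac{X+Y}{2},0,-\frac12,\frac12]$ and, for $1\le j\le 6n+1$, \[ \gamma_j:=\Big[\frac{y_{2j-1}X+1}{2},\ \frac{x_{2j-1}X-(-1)^j}{10},\ (-1)^j\frac{x_{2j-1}}{2},\ (-1)^j\frac{y_{2j-1}}{2}\Big]. \] $\mathcal{O}_K^+$ is the set of totally positive elements of $\mathcal{O}_K$; $\alpha\in\mathcal{O}_K^+$ is indecomposable if it is not a sum of two elements of $\mathcal{O}_K^+$; $\iota(K)$ is the number of indecomposables up to multiplication by totally positive units. *)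

(* Defs.v *)
From Stdlib Require Import Reals ZArith.
Open Scope R_scope.

(* Model of K = Q(sqrt5, sqrt p): an element [a,b,c,d] = a + b sqrt5 + c sqrt p + d sqrt(5p),
   stored by its four coordinates; membership in K requires rational coordinates. *)
Record el := El { e0 : R; e1 : R; e2 : R; e3 : R }.

Definition isQ (t : R) : Prop := exists a b : Z, b <> 0%Z /\ t = IZR a / IZR b.
Definition inK (a : el) : Prop := isQ (e0 a) /\ isQ (e1 a) /\ isQ (e2 a) /\ isQ (e3 a).

Definition el0 : el := El 0 0 0 0.
Definition el1 : el := El 1 0 0 0.
Definition eladd (a b : el) : el :=
  El (e0 a + e0 b) (e1 a + e1 b) (e2 a + e2 b) (e3 a + e3 b).
Definition elscale (c : R) (a : el) : el :=
  El (c * e0 a) (c * e1 a) (c * e2 a) (c * e3 a).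

(* multiplication, using sqrt5^2 = 5, sqrtp^2 = p, sqrt5 sqrtp = sqrt(5p), etc. *)
Definition elmul (p : Z) (a b : el) : el :=
  let P := IZR p in
  El (e0 a * e0 b + 5 * e1 a * e1 b + P * e2 a * e2 b + 5 * P * e3 a * e3 b)
     (e0 a * e1 b + e1 a * e0 b + P * (e2 a * e3 b + e3 a * e2 b))
     (e0 a * e2 b + e2 a * e0 b + 5 * (e1 a * e3 b + e3 a * e1 b))
     (e0 a * e3 b + e3 a * e0 b + e1 a * e2 b + e2 a * e1 b).

Fixpoint elpow (p : Z) (a : el) (k : nat) : el :=
  match k with O => el1 | S k' => elmul p a (elpow p a k') end.

Fixpoint polyval (p : Z) (c : nat -> Z) (a : el) (k : nat) : el :=
  match k with
  | O => el0
  | S k' => eladd (polyval p c a k') (elscale (IZR (c k')) (elpow p a k'))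
  end.

Definition in_OK (p : Z) (a : el) : Prop :=
  inK a /\ exists (d : nat) (c : nat -> Z), eladd (elpow p a d) (polyval p c a d) = el0.

Definition sg (b : bool) : R := if b then 1 else -1.

Definition sigma (p : Z) (s1 s2 : bool) (a : el) : R :=
  e0 a + sg s1 * e1 a * sqrt 5 + sg s2 * e2 a * sqrt (IZR p)
  + sg s1 * sg s2 * e3 a * sqrt (5 * IZR p).

Definition totpos (p : Z) (a : el) : Prop :=
  in_OK p a /\ forall s1 s2 : bool, 0 < sigma p s1 s2 a.

Definition indec (p : Z) (a : el) : Prop :=
  totpos p a /\ ~ (exists b c : el, totpos p b /\ totpos p c /\ a = eladd b c).

Definition is_unit (p : Z) (e : el) : Prop :=
  in_OK p e /\ exists f : el, in_OK p f /\ elmul p e f = el1.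

Definition tp_unit (p : Z) (e : el) : Prop := is_unit p e /\ totpos p e.

Definition assoc (p : Z) (a b : el) : Prop :=
  exists e : el, tp_unit p e /\ a = elmul p e b.

Definition complete_reps (p : Z) (m : nat) (f : nat -> el) : Prop :=
  (forall i, (i < m)%nat -> indec p (f i)) /\
  (forall i k, (i < m)%nat -> (k < m)%nat -> i <> k -> ~ assoc p (f i) (f k)) /\
  (forall a, indec p a -> exists i, (i < m)%nat /\ assoc p a (f i)).

Definition iota_eq (p : Z) (m : nat) : Prop := exists f : nat -> el, complete_reps p m f.

Fixpoint zcomb (z : nat -> Z) (w : nat -> el) (k : nat) : el :=
  match k with
  | O => el0
  | S k' => eladd (zcomb z w k') (elscale (IZR (z k')) (w k'))
  end.

Definition integral_basis (p : Z) (w : nat -> el) : Prop :=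
  (forall i, (i < 4)%nat -> in_OK p (w i)) /\
  (forall a, in_OK p a -> exists z : nat -> Z, a = zcomb z w 4) /\
  (forall z : nat -> Z, zcomb z w 4 = el0 -> forall i, (i < 4)%nat -> z i = 0%Z).

Definition emb1 (k : nat) : bool := match k with 0%nat | 1%nat => true | _ => false end.
Definition emb2 (k : nat) : bool := match k with 0%nat | 2%nat => true | _ => false end.

Definition det3 (m : nat -> nat -> R) (r0 r1 r2 c0 c1 c2 : nat) : R :=
  m r0 c0 * (m r1 c1 * m r2 c2 - m r1 c2 * m r2 c1)
  - m r0 c1 * (m r1 c0 * m r2 c2 - m r1 c2 * m r2 c0)
  + m r0 c2 * (m r1 c0 * m r2 c1 - m r1 c1 * m r2 c0).

Definition det4 (m : nat -> nat -> R) : R :=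
  m 0%nat 0%nat * det3 m 1 2 3 1 2 3 - m 0%nat 1%nat * det3 m 1 2 3 0 2 3
  + m 0%nat 2%nat * det3 m 1 2 3 0 1 3 - m 0%nat 3%nat * det3 m 1 2 3 0 1 2.

Definition disc_eq (p : Z) (D : R) : Prop :=
  exists w : nat -> el, integral_basis p w /\
    D = (det4 (fun k j => sigma p (emb1 k) (emb2 k) (w j))) ^ 2.

Definition Zsqfree (z : Z) : Prop := forall d : Z, (d * d | z)%Z -> Z.abs d = 1%Z.

(* Main.v *)
From Stdlib Require Import Reals ZArith Lra Lia Znumtheory.
Require Import Defs.
Open Scope R_scope.

(** Write phi = (1 + sqrt 5)/2, A = Z[phi], eps = Y + sqrt p, eta = X + sqrt r.  The hypotheses give
    O_K = A + A sqrt p, and eps, eta, phi^2 are totally positive units.  Taking logarithms of the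
    ratios of the two embeddings above each place of Q(sqrt 5), the units eps and eta generate the
    lattice spanned by (E,E) and (G,-G), where E = log eps <= G = log eta (up to a common factor),
    so modulo units every totally positive element lies, at both places, either in the cone spanned
    by 1 and eps or in the cone spanned by 1 and eta.

    The first cone is unimodular over A, so its only indecomposables are units.  In the second one
    an integer is lam + mu eta with lam, mu in A/sqrt 5 totally nonnegative and congruent modulo A,
    and its indecomposables are, up to units, 1 and delta_i = tau (1 + phi^(4i) eta), i in Z, where
    tau = 1/(sqrt 5 phi).  Now gamma_j = delta_(j/2) for j even, gamma_j is phi^2 times the conjugate
    of delta_((j-1)/2), hence associated to delta_(-(j-1)/2), for j odd, and rho is associated to
    delta_(-(3n+1)), which is associated to delta_(3n+1).

    For |i| <= 3n+1 a positive element of the codifferent has trace 1 against delta_i, so delta_i is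
    indecomposable.  For i = 3n+2 it is the sum of the units phi^(12n+4) eps and phi^2 eps eta, and
    for larger i it exceeds phi^2; negative i reduce to positive ones by conjugation.  The norm
    of delta_i is ((2X + phi^(4i) + phi^(-4i))/5)^2, which determines |i|, and
    delta_i / delta_(-i) is not integral for 0 < i <= 3n. *)

(** * The ring structure of [el] *)

(** The full unit group of K is never determined. To move an element into one of the two cones, the
    units generated by [eps], [eta] and phi^2 suffice; to separate two listed elements, an arbitrary
    unit is excluded by norms or by integrality of the quotient.

    The exponent 4i comes from the residue field of sqrt 5. There phi^2 = -1 and X = -1, so tau (z +
    w eta) is integral only if z = w modulo sqrt 5, and phi^(2k), phi^(2l) agree there exactly when
    k - l is even. The bound on i comes from the functional taking the value 1 at [delta i]: its
    positivity needs phi^(4i-2) < eta, and eta lies between phi^(m-1) and 2 phi^m with m = 12n + 3.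
    So phi^(m-1), the case i = 3n+1, is allowed, while phi^(m+3), the case i = 3n+2, is too large.

    Integrality is defined by monic polynomials, which gives no closure under sums or products. That
    closure is read off from O_K = A + A sqrt p, so this equality has to be proved first, through a
    ring attached to a single integral element. *)

Lemma El_ext (a b : el) :
  e0 a = e0 b -> e1 a = e1 b -> e2 a = e2 b -> e3 a = e3 b -> a = b.
Proof. destruct a, b; simpl; intros; congruence. Qed.

Definition elopp (a : el) : el := El (- e0 a) (- e1 a) (- e2 a) (- e3 a).
Definition elsub (a b : el) : el := eladd a (elopp b).

Ltac el_ring := intros; apply El_ext; simpl; ring.

Lemma el_ring_theory (p : Z) :
  ring_theory el0 el1 eladd (elmul p) elsub elopp (@eq el).
Proof. split; try reflexivity; el_ring. Qed.

Definition elconj (s1 s2 : bool) (a : el) : el :=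
  El (e0 a) (sg s1 * e1 a) (sg s2 * e2 a) (sg s1 * sg s2 * e3 a).

Lemma elconj_mul (p : Z) (s1 s2 : bool) (a b : el) :
  elconj s1 s2 (elmul p a b) = elmul p (elconj s1 s2 a) (elconj s1 s2 b).
Proof. destruct s1, s2; el_ring. Qed.

Lemma elconj_add (s1 s2 : bool) (a b : el) :
  elconj s1 s2 (eladd a b) = eladd (elconj s1 s2 a) (elconj s1 s2 b).
Proof. el_ring. Qed.

Lemma elconj_one (s1 s2 : bool) : elconj s1 s2 el1 = el1.
Proof. el_ring. Qed.

Lemma elconj_scale (s1 s2 : bool) (c : R) (a : el) :
  elconj s1 s2 (elscale c a) = elscale c (elconj s1 s2 a).
Proof. el_ring. Qed.

Lemma elconj_pow (p : Z) (s1 s2 : bool) (a : el) (k : nat) :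
  elconj s1 s2 (elpow p a k) = elpow p (elconj s1 s2 a) k.
Proof.
  induction k as [|k IH]; simpl; [apply elconj_one|].
  now rewrite elconj_mul, IH.
Qed.

Lemma elconj_invol (s1 s2 : bool) (a : el) : elconj s1 s2 (elconj s1 s2 a) = a.
Proof. destruct s1, s2; el_ring. Qed.

(** * Integrality *)

Definition isZ (t : R) : Prop := exists z : Z, t = IZR z.

Lemma isZ_IZR (z : Z) : isZ (IZR z).
Proof. now exists z. Qed.

Lemma isZ_add (s t : R) : isZ s -> isZ t -> isZ (s + t).
Proof. intros [a ->] [b ->]; exists (a + b)%Z; now rewrite plus_IZR. Qed.

Lemma isZ_mul (s t : R) : isZ s -> isZ t -> isZ (s * t).
Proof. intros [a ->] [b ->]; exists (a * b)%Z; now rewrite mult_IZR. Qed.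

Lemma isZ_opp (s : R) : isZ s -> isZ (- s).
Proof. intros [a ->]; exists (- a)%Z; now rewrite opp_IZR. Qed.

Lemma isZ_sub (s t : R) : isZ s -> isZ t -> isZ (s - t).
Proof. intros Hs Ht; apply isZ_add; [|apply isZ_opp]; assumption. Qed.

#[local] Hint Resolve isZ_IZR isZ_add isZ_mul isZ_opp isZ_sub : isz.

Definition latZ (a : el) : Prop := isZ (e0 a) /\ isZ (e1 a) /\ isZ (e2 a) /\ isZ (e3 a).

Lemma latZ_add (a b : el) : latZ a -> latZ b -> latZ (eladd a b).
Proof. intros (?&?&?&?) (?&?&?&?); repeat split; simpl; auto with isz. Qed.

Lemma latZ_scale (z : Z) (a : el) : latZ a -> latZ (elscale (IZR z) a).
Proof. intros (?&?&?&?); repeat split; simpl; auto with isz. Qed.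

Lemma latZ_mul (p : Z) (a b : el) : latZ a -> latZ b -> latZ (elmul p a b).
Proof. intros (?&?&?&?) (?&?&?&?); repeat split; simpl; auto 10 with isz. Qed.

Lemma latZ_conj (s1 s2 : bool) (a : el) : latZ a -> latZ (elconj s1 s2 a).
Proof.
  assert (Hs : forall s, isZ (sg s)) by (intros []; simpl; auto with isz).
  intros (?&?&?&?); repeat split; simpl; auto with isz.
Qed.

Lemma inK_mul (p : Z) (a b : el) : inK a -> inK b -> inK (elmul p a b).
Proof.
  assert (Hadd : forall s t, isQ s -> isQ t -> isQ (s + t)).
  { intros s t (a1&b1&H1&->) (a2&b2&H2&->); exists (a1 * b2 + a2 * b1)%Z, (b1 * b2)%Z.
    split; [nia|].
    rewrite plus_IZR, !mult_IZR; field; split; now apply not_0_IZR. }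
  assert (Hmul : forall s t, isQ s -> isQ t -> isQ (s * t)).
  { intros s t (a1&b1&H1&->) (a2&b2&H2&->); exists (a1 * a2)%Z, (b1 * b2)%Z.
    split; [nia|].
    rewrite !mult_IZR; field; split; now apply not_0_IZR. }
  assert (Hz : forall z, isQ (IZR z)) by (intros z; exists z, 1%Z; split; [lia|field]).
  intros (?&?&?&?) (?&?&?&?); repeat split; simpl; auto 10.
Qed.

Lemma inK_pow (p : Z) (a : el) (k : nat) : inK a -> inK (elpow p a k).
Proof.
  intros Ha; induction k as [|k IH]; simpl; [|now apply inK_mul].
  repeat split; simpl; [exists 1%Z| exists 0%Z | exists 0%Z | exists 0%Z];
    exists 1%Z; (split; [lia|field]).
Qed.

Lemma inK_denominator (a : el) :
  inK a -> exists N : Z, (0 < N)%Z /\ latZ (elscale (IZR N) a).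
Proof.
  assert (H : forall t, isQ t -> exists N : Z, (0 < N)%Z /\ isZ (IZR N * t)).
  (* The denominator v may be negative; its square is a positive one. *)
  { intros t (u&v&Hv&->); exists (v * v)%Z; split; [nia|].
    exists (v * u)%Z; rewrite !mult_IZR; field; now apply not_0_IZR. }
  intros (H0&H1&H2&H3).
  destruct (H _ H0) as (n0&P0&z0&Z0), (H _ H1) as (n1&P1&z1&Z1),
    (H _ H2) as (n2&P2&z2&Z2), (H _ H3) as (n3&P3&z3&Z3).
  exists (n0 * n1 * n2 * n3)%Z; split; [nia|].
  repeat split; simpl; rewrite !mult_IZR.
  - replace (_ * _) with (IZR n1 * IZR n2 * IZR n3 * (IZR n0 * e0 a)) by ring.
    rewrite Z0; auto with isz.
  - replace (_ * _) with (IZR n0 * IZR n2 * IZR n3 * (IZR n1 * e1 a)) by ring.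
    rewrite Z1; auto with isz.
  - replace (_ * _) with (IZR n0 * IZR n1 * IZR n3 * (IZR n2 * e2 a)) by ring.
    rewrite Z2; auto with isz.
  - replace (_ * _) with (IZR n0 * IZR n1 * IZR n2 * (IZR n3 * e3 a)) by ring.
    rewrite Z3; auto with isz.
Qed.

Lemma powers_denominator (p : Z) (a : el) (d : nat) :
  inK a -> exists N : Z, (0 < N)%Z /\
    forall k, (k < d)%nat -> latZ (elscale (IZR N) (elpow p a k)).
Proof.
  intros Ha; induction d as [|d (N&HN&IH)]; [exists 1%Z; split; [lia|lia]|].
  destruct (inK_denominator _ (inK_pow p a d Ha)) as (M&HM&HL).
  exists (M * N)%Z; split; [nia|]; intros k Hk.
  destruct (Nat.eq_dec k d) as [->|Hkd].
  - replace (elscale _ _) with (elscale (IZR N) (elscale (IZR M) (elpow p a d)))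
      by (rewrite mult_IZR; el_ring).
    now apply latZ_scale.
  - replace (elscale _ _) with (elscale (IZR M) (elscale (IZR N) (elpow p a k)))
      by (rewrite mult_IZR; el_ring).
    apply latZ_scale, IH; lia.
Qed.

Section Integrality.
Variable p : Z.
Add Ring el_ring_p : (el_ring_theory p).

Lemma elpow_add (a : el) (i j : nat) :
  elpow p a (i + j) = elmul p (elpow p a i) (elpow p a j).
Proof. induction i as [|i IH]; simpl; [|rewrite IH]; ring. Qed.

Lemma elscale_add (c : R) (a b : el) : elscale c (eladd a b) = eladd (elscale c a) (elscale c b).
Proof. el_ring. Qed.

(** A common denominator of the powers below the degree of the monic equation serves for all powers,
    since the equation rewrites each higher power as an integral combination of lower ones. *)
Lemma integral_bounded (a : el) :
  in_OK p a -> exists N : Z, (0 < N)%Z /\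
    forall k, latZ (elscale (IZR N) (elpow p a k)).
Proof.
  intros (Ha&d&c&Hc).
  destruct (powers_denominator p a d Ha) as (N&HN&HL).
  exists N; split; [assumption|].
  assert (Hpoly : forall e k, (forall j, (j < e)%nat -> latZ (elscale (IZR N) (elpow p a (k + j)))) ->
     latZ (elscale (IZR N) (elmul p (elpow p a k) (polyval p c a e)))).
  { induction e as [|e IH]; intros k Hk; simpl.
    - replace (elmul _ _ _) with el0 by ring.
      repeat split; simpl; rewrite Rmult_0_r; auto with isz.
    - replace (elscale (IZR N) _) with
        (eladd (elscale (IZR N) (elmul p (elpow p a k) (polyval p c a e)))
               (elscale (IZR (c e)) (elscale (IZR N) (elmul p (elpow p a k) (elpow p a e)))))
        by el_ring.
      apply latZ_add; [apply IH; intros; apply Hk; lia|].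
      apply latZ_scale; rewrite <- elpow_add; apply Hk; lia. }
  induction k as [k IH] using (well_founded_induction lt_wf).
  destruct (Nat.lt_ge_cases k d) as [Hk|Hk]; [now apply HL|].
  replace k with ((k - d) + d)%nat by lia.
  assert (He : elpow p a (k - d + d) =
    elscale (IZR (-1)) (elmul p (elpow p a (k - d)) (polyval p c a d))).
  { rewrite elpow_add.
    replace (elpow p a d) with (elsub (eladd (elpow p a d) (polyval p c a d)) (polyval p c a d))
      by ring.
    rewrite Hc; el_ring. }
  destruct d as [|d].
  { exfalso; simpl in Hc; apply (f_equal e0) in Hc; simpl in Hc; lra. }
  rewrite He.
  replace (elscale (IZR N) _) with (elscale (IZR (-1)) (elscale (IZR N)
     (elmul p (elpow p a (k - S d)) (polyval p c a (S d))))) by el_ring.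
  apply latZ_scale, Hpoly; intros j Hj; apply IH; lia.
Qed.

Definition conj_monomial (a : el) (i j k l : nat) : el :=
  elmul p (elmul p (elpow p a i) (elpow p (elconj true false a) j))
          (elmul p (elpow p (elconj false true a) k) (elpow p (elconj false false a) l)).

(* [conj_ring N a] contains [Z[a, a', a'', a''']]; since the latter has bounded
   denominators [N], its rational elements are integers. *)
Definition conj_module (N : Z) (a y : el) : Prop :=
  forall i j k l, latZ (elscale (IZR N) (elmul p y (conj_monomial a i j k l))).

Definition conj_ring (N : Z) (a x : el) : Prop :=
  forall y, conj_module N a y -> conj_module N a (elmul p x y).

Lemma conj_module_add N a x y :
  conj_module N a x -> conj_module N a y -> conj_module N a (eladd x y).
Proof.
  intros Hx Hy i j k l.
  replace (elmul p (eladd x y) (conj_monomial a i j k l)) with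
    (eladd (elmul p x (conj_monomial a i j k l)) (elmul p y (conj_monomial a i j k l))) by ring.
  rewrite elscale_add; now apply latZ_add.
Qed.

Lemma conj_ring_add N a x y : conj_ring N a x -> conj_ring N a y -> conj_ring N a (eladd x y).
Proof.
  intros Hx Hy z Hz.
  replace (elmul p (eladd x y) z) with (eladd (elmul p x z) (elmul p y z)) by ring.
  apply conj_module_add; auto.
Qed.

(** This is the gain from defining [conj_ring] as a multiplier ring: a product acts by acting twice,
    and no expansion into monomials is needed. *)
Lemma conj_ring_mul N a x y : conj_ring N a x -> conj_ring N a y -> conj_ring N a (elmul p x y).
Proof.
  intros Hx Hy z Hz.
  replace (elmul p (elmul p x y) z) with (elmul p x (elmul p y z)) by ring.
  auto.
Qed.

Lemma conj_ring_IZR N a z : conj_ring N a (El (IZR z) 0 0 0).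
Proof.
  intros y Hy i j k l.
  replace (elscale _ _) with
    (elscale (IZR z) (elscale (IZR N) (elmul p y (conj_monomial a i j k l)))) by el_ring.
  apply latZ_scale, Hy.
Qed.

Lemma conj_ring_pow N a x k : conj_ring N a x -> conj_ring N a (elpow p x k).
Proof.
  intros Hx; induction k as [|k IH]; simpl; [apply (conj_ring_IZR N a 1)|].
  now apply conj_ring_mul.
Qed.

Lemma conj_ring_conj N a s1 s2 : conj_ring N a (elconj s1 s2 a).
Proof.
  intros y Hy i j k l.
  assert (Hid : elconj true true a = a) by el_ring.
  destruct s1, s2; [rewrite Hid| | |].
  - replace (elmul p _ _) with (elmul p y (conj_monomial a (S i) j k l))
      by (unfold conj_monomial; simpl; ring); apply Hy.
  - replace (elmul p _ _) with (elmul p y (conj_monomial a i (S j) k l))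
      by (unfold conj_monomial; simpl; ring); apply Hy.
  - replace (elmul p _ _) with (elmul p y (conj_monomial a i j (S k) l))
      by (unfold conj_monomial; simpl; ring); apply Hy.
  - replace (elmul p _ _) with (elmul p y (conj_monomial a i j k (S l)))
      by (unfold conj_monomial; simpl; ring); apply Hy.
Qed.

(** Conjugation preserves integral coordinates, so one N bounds the powers of all four conjugates; a
    monomial has four such factors, whence the denominator N^4. *)
Lemma conj_ring_denominator (a : el) :
  in_OK p a -> exists N : Z, (0 < N)%Z /\ conj_module N a el1.
Proof.
  intros Ha; destruct (integral_bounded a Ha) as (N&HN&HL).
  exists (N * N * (N * N))%Z; split; [nia|]; intros i j k l.
  replace (elscale _ _) with
    (elmul p (elmul p (elscale (IZR N) (elpow p a i)) (elscale (IZR N) (elpow p (elconj true false a) j)))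
       (elmul p (elscale (IZR N) (elpow p (elconj false true a) k))
                (elscale (IZR N) (elpow p (elconj false false a) l))))
    by (rewrite !mult_IZR; unfold conj_monomial; el_ring).
  rewrite <- !elconj_pow, <- !elconj_scale.
  auto 10 using latZ_mul, latZ_conj.
Qed.

Lemma elpow_rat (t : R) (k : nat) : elpow p (El t 0 0 0) k = El (t ^ k) 0 0 0.
Proof. induction k as [|k IH]; simpl; [reflexivity|rewrite IH; el_ring]. Qed.

(* The fractional part [f] of [t] satisfies [N f^k] integer for all [k], and [f^k -> 0]. *)
Lemma conj_ring_rational (N : Z) (a : el) (t : R) :
  (0 < N)%Z -> conj_module N a el1 -> conj_ring N a (El t 0 0 0) -> isZ t.
Proof.
  intros HN H1 Ht.
  set (f := t - IZR (Int_part t)).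
  assert (Hf : 0 <= f < 1) by (unfold f; destruct (base_Int_part t); lra).
  assert (HF : conj_ring N a (El f 0 0 0)).
  { replace (El f 0 0 0) with (eladd (El t 0 0 0) (El (IZR (- Int_part t)) 0 0 0))
      by (rewrite opp_IZR; unfold f; el_ring).
    apply conj_ring_add; [assumption|apply conj_ring_IZR]. }
  assert (HNf : forall k, isZ (IZR N * f ^ k)).
  { intros k.
    specialize (conj_ring_pow N a _ k HF el1 H1 0%nat 0%nat 0%nat 0%nat) as [H _].
    rewrite elpow_rat in H; unfold conj_monomial in H; simpl in H.
    replace (IZR N * f ^ k) with (IZR N *
     ((f ^ k * 1 + 5 * 0 * 0 + IZR p * 0 * 0 + 5 * IZR p * 0 * 0) * 1)) by ring.
    match type of H with isZ ?u => match goal with |- isZ ?v =>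
      replace v with u by ring end end; exact H. }
  assert (HNR : 0 < IZR N) by (now apply IZR_lt).
  destruct (pow_lt_1_zero f) with (y := / IZR N) as (k&Hk).
  { rewrite Rabs_pos_eq; lra. }
  { now apply Rinv_0_lt_compat. }
  specialize (Hk k (le_n k)).
  assert (Hpos : 0 <= f ^ k) by (apply pow_le; lra).
  rewrite Rabs_pos_eq in Hk by assumption.
  destruct (HNf k) as (z&Hz).
  assert (Hlt : IZR N * f ^ k < 1).
  { apply Rmult_lt_reg_l with (/ IZR N); [now apply Rinv_0_lt_compat|].
    rewrite <- Rmult_assoc, Rinv_l, Rmult_1_l, Rmult_1_r by lra; assumption. }
  assert (Hz0 : z = 0%Z).
  { assert (0 <= IZR z < 1) by (rewrite <- Hz; split; [apply Rmult_le_pos; lra|assumption]).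
    destruct H as [Hl Hu]; apply le_IZR in Hl; apply lt_IZR in Hu; lia. }
  rewrite Hz0 in Hz.
  assert (Hf0 : f ^ k = 0) by nra.
  assert (Hff : f = 0).
  { destruct (Req_dec f 0) as [|Hne]; [assumption|].
    exfalso; now apply (pow_nonzero f k Hne). }
  exists (Int_part t); unfold f in Hff; lra.
Qed.

End Integrality.

(** * The ring of integers as A + A sqrt p *)

Lemma sqfree_sqrt_integral (q : Z) (t : R) :
  Zsqfree q -> isQ t -> isZ (IZR q * (t * t)) -> isZ t.
Proof.
  intros Hq (a&b&Hb&->) (k&Hk).
  set (g := Z.gcd a b).
  assert (Hg : (g <> 0)%Z).
  { unfold g; intros H; apply Z.gcd_eq_0_r in H; contradiction. }
  destruct (Z.gcd_divide_l a b) as (a'&Ha'), (Z.gcd_divide_r a b) as (b'&Hb').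
  fold g in Ha', Hb'.
  assert (Hcop : rel_prime b' a').
  { apply rel_prime_sym, Zgcd_1_rel_prime.
    assert (H : (Z.gcd (a' * g) (b' * g) = Z.gcd a' b' * Z.abs g)%Z) by apply Z.gcd_mul_mono_r.
    rewrite <- Ha', <- Hb' in H; fold g in H.
    assert (0 <= g)%Z by apply Z.gcd_nonneg.
    rewrite Z.abs_eq in H by assumption; nia. }
  assert (Hb0 : (b' <> 0)%Z) by (intros ->; lia).
  assert (Hid : (q * (a' * a') = k * (b' * b'))%Z).
  { apply eq_IZR; rewrite !mult_IZR, <- Hk, Ha', Hb', !mult_IZR.
    field; split; apply not_0_IZR; assumption. }
  assert (Hdiv : (b' * b' | q)%Z).
  { apply Gauss with (a' * a')%Z.
    - exists k; rewrite Z.mul_comm; exact Hid.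
    - apply rel_prime_mult; apply rel_prime_sym, rel_prime_mult; now apply rel_prime_sym. }
  apply Hq in Hdiv.
  exists (a' * Z.sgn b')%Z.
  rewrite Ha', Hb', !mult_IZR.
  assert (Hb1 : b' = 1%Z \/ b' = (-1)%Z) by lia.
  assert (IZR g <> 0) by (now apply not_0_IZR).
  destruct Hb1 as [-> | ->]; simpl; field; assumption.
Qed.

Lemma sqfree_5 : Zsqfree 5.
Proof.
  intros d (k&Hk).
  assert (Hk0 : (0 < k)%Z) by nia.
  assert (Hd2 : (d * d <= 5)%Z) by nia.
  assert (Hd : (-3 < d < 3)%Z) by nia.
  assert (d = -2 \/ d = -1 \/ d = 0 \/ d = 1 \/ d = 2)%Z as [->|[->|[->|[->| ->]]]] by lia; lia.
Qed.

(* [x + y phi + (z + t phi) sqrt p] with [phi = (1 + sqrt 5) / 2]. *)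
Definition elZ (x y z t : Z) : el :=
  El (IZR x + IZR y / 2) (IZR y / 2) (IZR z + IZR t / 2) (IZR t / 2).

Lemma in_OK_elZ (p x y z t : Z) : in_OK p (elZ x y z t).
Proof.
  split.
  - repeat split; simpl; [exists (2 * x + y)%Z | exists y | exists (2 * z + t)%Z | exists t];
      exists 2%Z; (split; [lia|rewrite ?plus_IZR, ?mult_IZR; field]).
  (* With u = x + y phi, the relative norm over A is N = n0 + n1 phi. The quartic below is the
     characteristic polynomial, the product of T^2 - 2 u T + N and its conjugate over Q. *)
  - set (n0 := (x * x + y * y - p * (z * z + t * t))%Z).
    set (n1 := (2 * x * y + y * y - p * (2 * z * t + t * t))%Z).
    exists 4%nat, (fun k => match k with
      | 0%nat => n0 * n0 + n0 * n1 - n1 * n1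
      | 1%nat => - (4 * x * n0 + 2 * x * n1 + 2 * y * n0 - 4 * y * n1)
      | 2%nat => 2 * n0 + n1 + 4 * (x * x + x * y - y * y)
      | _ => - (4 * x + 2 * y) end)%Z.
    unfold n0, n1.
    apply El_ext; cbv [elZ polyval elpow elmul eladd elscale el0 el1 e0 e1 e2 e3];
      repeat rewrite ?plus_IZR, ?minus_IZR, ?opp_IZR, ?mult_IZR; field.
Qed.

Lemma even_cases (a : Z) : exists b, (a = 2 * b \/ a = 2 * b + 1)%Z.
Proof. destruct (Z.Even_or_Odd a) as [[b ->]|[b ->]]; exists b; lia. Qed.

(** Rational expressions in the conjugates are integers by [conj_ring_rational]. They first bring
    the denominators of all coordinates down to 4; congruences modulo 4 then give the parities that
    characterise A + A sqrt p. *)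
Lemma in_OK_form (p : Z) (a : el) :
  Zsqfree p -> Zsqfree (5 * p) -> (exists k, p = 4 * k + 3)%Z ->
  in_OK p a -> exists x y z t, a = elZ x y z t.
Proof.
  intros Hp Hr (kp&Hkp) Ha.
  destruct (conj_ring_denominator p a Ha) as (N&HN&H1).
  assert (HZ : forall t, conj_ring p N a (El t 0 0 0) -> isZ t)
    by (intros t; now apply conj_ring_rational with (1 := HN)).
  assert (HC : forall s1 s2, conj_ring p N a (elconj s1 s2 a)) by (intros; apply conj_ring_conj).
  assert (HA := conj_ring_add p N a); assert (HM := conj_ring_mul p N a).
  destruct a as [a b c d].
  set (al := El a b c d) in *.
  set (c1 := elconj true true al); set (c2 := elconj true false al);
  set (c3 := elconj false true al); set (c4 := elconj false false al).
  assert (K1 : conj_ring p N al c1) by apply HC.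
  assert (K2 : conj_ring p N al c2) by apply HC.
  assert (K3 : conj_ring p N al c3) by apply HC.
  assert (K4 : conj_ring p N al c4) by apply HC.
  (* [T1] is the trace; [T5], [Tp], [Tr] are the norms of the relative traces to the three quadratic
     subfields; [T6], [T7] are the trace and the norm of the relative norm to Q(sqrt 5). *)
  assert (T1 : isZ (4 * a)).
  { apply HZ.
    replace (El (4 * a) 0 0 0) with (eladd (eladd c1 c2) (eladd c3 c4)) by el_ring; auto. }
  assert (T5 : isZ (4 * (a * a) - 20 * (b * b))).
  { apply HZ.
    replace (El _ 0 0 0) with (elmul p (eladd c1 c2) (eladd c3 c4)) by el_ring; auto. }
  assert (Tp : isZ (4 * (a * a) - 4 * IZR p * (c * c))).
  { apply HZ.
    replace (El _ 0 0 0) with (elmul p (eladd c1 c3) (eladd c2 c4)) by el_ring; auto. }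
  assert (Tr : isZ (4 * (a * a) - 20 * IZR p * (d * d))).
  { apply HZ.
    replace (El _ 0 0 0) with (elmul p (eladd c1 c4) (eladd c2 c3)) by el_ring; auto. }
  assert (T6 : isZ (2 * (a * a + 5 * (b * b) - IZR p * (c * c + 5 * (d * d))))).
  { apply HZ.
    replace (El _ 0 0 0) with (eladd (elmul p c1 c2) (elmul p c3 c4)) by el_ring; auto. }
  assert (T7 : isZ ((a * a + 5 * (b * b) - IZR p * (c * c + 5 * (d * d))) ^ 2
                    - 20 * (a * b - IZR p * (c * d)) ^ 2)).
  { apply HZ.
    replace (El _ 0 0 0) with (elmul p (elmul p c1 c2) (elmul p c3 c4)) by el_ring; auto. }
  destruct Ha as ((_&Qb&Qc&Qd)&_); simpl in Qb, Qc, Qd.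
  assert (HQ4 : forall t, isQ t -> isQ (4 * t)).
  { intros t (u&v&Hv&->); exists (4 * u)%Z, v; split; [assumption|].
    rewrite mult_IZR; field; now apply not_0_IZR. }
  assert (B4 : isZ (4 * b)).
  { apply (sqfree_sqrt_integral 5); [apply sqfree_5|auto|].
    replace (5 * (4 * b * (4 * b))) with (4 * a * (4 * a) - 4 * (4 * (a * a) - 20 * (b * b))) by ring.
    auto with isz. }
  assert (C4 : isZ (4 * c)).
  { apply (sqfree_sqrt_integral p); [assumption|auto|].
    replace (IZR p * (4 * c * (4 * c))) with
      (4 * a * (4 * a) - 4 * (4 * (a * a) - 4 * IZR p * (c * c))) by ring.
    auto with isz. }
  assert (D4 : isZ (4 * d)).
  { apply (sqfree_sqrt_integral (5 * p)); [assumption|auto|].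
    replace (IZR (5 * p) * (4 * d * (4 * d))) with
      (4 * a * (4 * a) - 4 * (4 * (a * a) - 20 * IZR p * (d * d))) by (rewrite mult_IZR; ring).
    auto with isz. }
  destruct T1 as (A&HA4), B4 as (B&HB4), C4 as (C&HC4), D4 as (D&HD4).
  assert (Ea : a = IZR A / 4) by lra. assert (Eb : b = IZR B / 4) by lra.
  assert (Ec : c = IZR C / 4) by lra. assert (Ed : d = IZR D / 4) by lra.
  clear HZ HC HA HM K1 K2 K3 K4 c1 c2 c3 c4 H1; unfold al; clear al.
  rewrite Ea, Eb, Ec, Ed in *; clear Ea Eb Ec Ed a b c d HA4 HB4 HC4 HD4 Qb Qc Qd.
  destruct T5 as (z5&T5), Tp as (zp&Tp), Tr as (zr&Tr).
  assert (E5 : (A * A - 5 * (B * B) = 4 * z5)%Z).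
  { apply eq_IZR; rewrite minus_IZR, !mult_IZR, <- T5; field. }
  assert (Ep : (A * A - p * (C * C) = 4 * zp)%Z).
  { apply eq_IZR; rewrite minus_IZR, !mult_IZR, <- Tp; field. }
  assert (Er : (A * A - 5 * p * (D * D) = 4 * zr)%Z).
  { apply eq_IZR; rewrite minus_IZR, !mult_IZR, <- Tr; field. }
  (* Modulo 4 the coefficients 5, p, 5p are 1, 3, 3. Hence [Ep] makes A and C even, and then [E5]
     and [Er] make B and D even. *)
  destruct (even_cases A) as (a&HA), (even_cases B) as (b&HB),
    (even_cases C) as (c&HC), (even_cases D) as (d&HD).
  assert (EA : A = (2 * a)%Z).
  { destruct HA as [HA|HA]; [assumption|exfalso].
    destruct HC as [HC|HC]; subst A C p; ring_simplify in Ep; lia. }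
  assert (EB : B = (2 * b)%Z).
  { destruct HB as [HB|HB]; [assumption|exfalso]; subst A B; ring_simplify in E5; lia. }
  assert (EC : C = (2 * c)%Z).
  { destruct HC as [HC|HC]; [assumption|exfalso]; subst A C p; ring_simplify in Ep; lia. }
  assert (ED : D = (2 * d)%Z).
  { destruct HD as [HD|HD]; [assumption|exfalso]; subst A D p; ring_simplify in Er; lia. }
  clear HA HB HC HD T5 Tp Tr E5 Ep Er; subst A B C D.
  destruct T6 as (z6&T6), T7 as (z7&T7).
  set (Q := (a * b - p * c * d)%Z).
  assert (E6 : (a * a + 5 * (b * b) - p * (c * c + 5 * (d * d)) = 2 * z6)%Z).
  { apply eq_IZR; rewrite !minus_IZR, !plus_IZR, !mult_IZR, !plus_IZR, !mult_IZR, <- T6, !mult_IZR; field. }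
  assert (E7 : (z6 * z6 - 5 * (Q * Q) = 4 * z7)%Z).
  { apply eq_IZR; unfold Q.
    rewrite !minus_IZR, !mult_IZR, !minus_IZR, !mult_IZR, <- T7, <- T6, !mult_IZR; field. }
  assert (EQ : exists j, (z6 = Q + 2 * j)%Z).
  { destruct (even_cases z6) as (u&[Hu|Hu]), (even_cases Q) as (v&[Hv|Hv]); rewrite Hu, Hv in *;
    try (exists (u - v)%Z; lia); exfalso; ring_simplify in E7; lia. }
  destruct EQ as (j&Hj).
  (* Putting z6 = Q + 2j into [E6] and using p = -1 modulo 4 leaves a sum of two squares divisible
     by 4, so both a - b and c - d are even. *)
  assert (E8 : ((a - b) * (a - b) + (c - d) * (c - d) = 4 * (j - b * b + p * d * d +
     (kp + 1) * (c * c + d * d - 2 * (c * d))))%Z).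
  { unfold Q in Hj; rewrite Hj in E6.
    subst p; ring_simplify in E6; ring_simplify; lia. }
  destruct (even_cases (a - b)) as (s&Hs), (even_cases (c - d)) as (t&Ht).
  assert (Es : (a - b = 2 * s)%Z).
  { destruct Hs as [Hs|Hs]; [assumption|exfalso].
    destruct Ht as [Ht|Ht]; rewrite Hs, Ht in E8; ring_simplify in E8; lia. }
  assert (Et : (c - d = 2 * t)%Z).
  { destruct Ht as [Ht|Ht]; [assumption|exfalso].
    rewrite Es, Ht in E8; ring_simplify in E8; lia. }
  exists s, b, t, d.
  assert (a = 2 * s + b)%Z by lia. assert (c = 2 * t + d)%Z by lia. subst a c.
  apply El_ext; cbv [elZ e0 e1 e2 e3]; repeat rewrite ?mult_IZR, ?plus_IZR; field.
Qed.

(** * The ring [Z[phi]] at its two real places *)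

Definition phi : R := (1 + sqrt 5) / 2.
Definition psi : R := (1 - sqrt 5) / 2.

Lemma sqrt5_sq : sqrt 5 * sqrt 5 = 5.
Proof. apply sqrt_sqrt; lra. Qed.

Lemma sqrt5_bounds : 2.236 < sqrt 5 < 2.2361.
Proof.
  assert (H := sqrt5_sq); assert (0 <= sqrt 5) by apply sqrt_pos; split; nra.
Qed.

Lemma phi_sq : phi * phi = phi + 1.
Proof. unfold phi; assert (H := sqrt5_sq); nra. Qed.

Lemma sqrt5_phi : sqrt 5 = 2 * phi - 1.
Proof. unfold phi; field. Qed.

Lemma psi_phi : psi = 1 - phi.
Proof. unfold phi, psi; field. Qed.

Lemma phi_bounds : 1.618 < phi < 1.61805.
Proof. unfold phi; assert (H := sqrt5_bounds); lra. Qed.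

Lemma phi_inv : / phi = phi - 1.
Proof.
  assert (H := phi_bounds).
  apply Rmult_eq_reg_l with phi; [|lra]; rewrite Rinv_r by lra.
  assert (E := phi_sq); lra.
Qed.

(** An element of A is carried as the pair of its real conjugates, so that total positivity is a
    pair of inequalities between reals. *)
Definition inA (z1 z2 : R) : Prop :=
  exists a b : Z, z1 = IZR a + IZR b * phi /\ z2 = IZR a + IZR b * psi.

Lemma inA_add z1 z2 w1 w2 : inA z1 z2 -> inA w1 w2 -> inA (z1 + w1) (z2 + w2).
Proof.
  intros (a&b&->&->) (c&d&->&->); exists (a + c)%Z, (b + d)%Z.
  rewrite !plus_IZR; split; ring.
Qed.

Lemma inA_opp z1 z2 : inA z1 z2 -> inA (- z1) (- z2).
Proof. intros (a&b&->&->); exists (- a)%Z, (- b)%Z; rewrite !opp_IZR; split; ring. Qed.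

Lemma inA_sub z1 z2 w1 w2 : inA z1 z2 -> inA w1 w2 -> inA (z1 - w1) (z2 - w2).
Proof. intros Hz Hw; apply inA_add; [|apply inA_opp]; assumption. Qed.

Lemma inA_mul z1 z2 w1 w2 : inA z1 z2 -> inA w1 w2 -> inA (z1 * w1) (z2 * w2).
Proof.
  intros (a&b&->&->) (c&d&->&->); exists (a * c + b * d)%Z, (a * d + b * c + b * d)%Z.
  rewrite !plus_IZR, !mult_IZR, psi_phi.
  split; ring [phi_sq].
Qed.

Lemma inA_IZR (z : Z) : inA (IZR z) (IZR z).
Proof. exists z, 0%Z; split; ring. Qed.

Lemma inA_phi : inA phi psi.
Proof. exists 0%Z, 1%Z; split; ring. Qed.

Lemma inA_sqrt5 : inA (sqrt 5) (- sqrt 5).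
Proof. exists (-1)%Z, 2%Z; rewrite psi_phi, sqrt5_phi; split; ring. Qed.

Lemma inA_swap z1 z2 : inA z1 z2 -> inA z2 z1.
Proof.
  intros (a&b&->&->); exists (a + b)%Z, (- b)%Z.
  rewrite plus_IZR, opp_IZR, psi_phi; split; ring.
Qed.

#[local] Hint Resolve inA_add inA_opp inA_sub inA_mul inA_IZR inA_phi inA_sqrt5 : ina.

Lemma inA_norm z1 z2 : inA z1 z2 -> isZ (z1 * z2).
Proof.
  intros (a&b&->&->); exists (a * a + a * b - b * b)%Z.
  rewrite minus_IZR, plus_IZR, !mult_IZR, psi_phi.
  ring [phi_sq].
Qed.

Lemma inA_diff z1 z2 : inA z1 z2 -> isZ ((z1 - z2) / sqrt 5).
Proof.
  assert (H := sqrt5_bounds).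
  intros (a&b&->&->); exists b; rewrite psi_phi; unfold phi; field; lra.
Qed.

(** Irrationality of sqrt 5, from the squarefree lemma applied to t/s, whose square times 5 is 1. *)
Lemma square_neq_5_square (s t : Z) : (s * s = 5 * (t * t))%Z -> t = 0%Z.
Proof.
  intros H; destruct (Z.eq_dec t 0) as [|Ht]; [assumption|exfalso].
  assert (Hs : s <> 0%Z) by nia.
  assert (HsR : IZR s <> 0) by (now apply not_0_IZR).
  destruct (sqfree_sqrt_integral 5 (IZR t / IZR s)) as (z&Hz).
  - apply sqfree_5.
  - now exists t, s.
  - exists 1%Z.
    apply (f_equal IZR) in H; rewrite !mult_IZR in H.
    apply Rmult_eq_reg_r with (IZR s * IZR s); [|nra].
    transitivity (5 * (IZR t * IZR t)); [field; assumption|lra].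
  - assert (Ht' : (t = z * s)%Z).
    { apply eq_IZR; rewrite mult_IZR, <- Hz; field; assumption. }
    subst t; assert (H0 : (s * s * (1 - 5 * (z * z)) = 0)%Z) by lia.
    apply Z.mul_eq_0 in H0; destruct H0 as [H0|H0]; [nia|lia].
Qed.

(** A vanishing conjugate makes the norm a^2 + ab - b^2 vanish; completing the square gives (2a +
    b)^2 = 5 b^2, so a = b = 0. *)
Lemma inA_zero z1 z2 : inA z1 z2 -> z1 = 0 -> z2 = 0.
Proof.
  intros (a&b&E1&E2) H.
  assert (Hab : (a * a + a * b - b * b = 0)%Z).
  { apply eq_IZR; rewrite minus_IZR, plus_IZR, !mult_IZR.
    replace (IZR a * IZR a + IZR a * IZR b - IZR b * IZR b) with
      (z1 * (IZR a + IZR b * psi)) by (rewrite E1, psi_phi; ring [phi_sq]).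
    rewrite H; ring. }
  assert (Hb : b = 0%Z) by (apply (square_neq_5_square (2 * a + b)); nia).
  subst b; assert (a = 0)%Z by nia; subst a.
  rewrite E2; ring.
Qed.

Lemma inA_zero_r z1 z2 : inA z1 z2 -> z2 = 0 -> z1 = 0.
Proof. intros H; apply inA_zero; now apply inA_swap. Qed.

(** * Powers of phi and totally positive elements of A *)

#[local] Notation P := (powerRZ phi).

Lemma phi_neq_0 : phi <> 0.
Proof. assert (H := phi_bounds); lra. Qed.

Lemma P_pos (k : Z) : 0 < P k.
Proof. apply powerRZ_lt; assert (H := phi_bounds); lra. Qed.

Lemma P_add (i j : Z) : P (i + j) = P i * P j.
Proof. apply powerRZ_add, phi_neq_0. Qed.

Lemma P_neg (k : Z) : P (- k) = / P k.
Proof. apply powerRZ_neg'. Qed.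

Lemma P_mul_neg (k : Z) : P k * P (- k) = 1.
Proof. rewrite P_neg; apply Rinv_r; assert (H := P_pos k); lra. Qed.

Lemma P_lt (i j : Z) : (i < j)%Z -> P i < P j.
Proof.
  intros H; assert (B := phi_bounds).
  rewrite !powerRZ_Rpower by lra.
  apply Rpower_lt; [lra|now apply IZR_lt].
Qed.

Lemma P_le (i j : Z) : (i <= j)%Z -> P i <= P j.
Proof.
  intros H; destruct (Z.eq_dec i j) as [->|]; [lra|].
  left; apply P_lt; lia.
Qed.

Lemma P_2 : P 2 = phi + 1.
Proof. simpl; rewrite Rmult_1_r; apply phi_sq. Qed.

Lemma P_m2 : P (-2) = 2 - phi.
Proof.
  assert (H := P_mul_neg 2); change (- (2))%Z with (-2)%Z in H.
  rewrite P_2 in H; assert (E := phi_sq); assert (B := phi_bounds).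
  apply Rmult_eq_reg_l with (phi + 1); nra.
Qed.

(** Since psi = -1/phi, an even power of phi is totally positive and its conjugate is its
    inverse. *)
Lemma inA_unit (k : Z) : inA (P (2 * k)) (P (- (2 * k))).
Proof.
  assert (H2 : inA (P 2) (P (-2))).
  { rewrite P_2, P_m2; exists 1%Z, 1%Z; rewrite psi_phi; split; ring. }
  assert (Hn : forall j : nat, inA (P (2 * Z.of_nat j)) (P (- (2 * Z.of_nat j)))).
  { induction j as [|j IH]; [apply (inA_IZR 1)|].
    replace (2 * Z.of_nat (S j))%Z with (2 + 2 * Z.of_nat j)%Z by lia.
    rewrite Z.opp_add_distr, !P_add; apply inA_mul; assumption. }
  destruct (Z_le_gt_dec 0 k) as [Hk|Hk].
  - rewrite <- (Z2Nat.id k) by lia; apply Hn.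
  - apply inA_swap; specialize (Hn (Z.to_nat (- k))).
    rewrite Z2Nat.id in Hn by lia.
    replace (- (2 * k))%Z with (2 * - k)%Z by lia.
    now replace (2 * k)%Z with (- (2 * - k))%Z by lia.
Qed.

#[local] Hint Resolve inA_unit : ina.

Lemma powerRZ_floor (q x : R) :
  1 < q -> 0 < x -> exists k : Z, powerRZ q k <= x < powerRZ q (k + 1).
Proof.
  intros Hq Hx.
  assert (Hl : 0 < ln q) by (rewrite <- ln_1; apply ln_increasing; lra).
  set (k := Int_part (ln x / ln q)).
  destruct (base_Int_part (ln x / ln q)) as [B1 B2]; fold k in B1, B2.
  assert (Ex : x = exp ((ln x / ln q) * ln q)).
  { replace (ln x / ln q * ln q) with (ln x) by (field; lra).
    now rewrite exp_ln. }
  exists k; rewrite !powerRZ_Rpower by lra; unfold Rpower; rewrite plus_IZR.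
  rewrite Ex; split.
  - assert (Hle : IZR k * ln q <= ln x / ln q * ln q) by (apply Rmult_le_compat_r; lra).
    destruct Hle as [Hlt|Heq]; [left; now apply exp_increasing|right; now rewrite Heq].
  - apply exp_increasing, Rmult_lt_compat_r; lra.
Qed.

(** The cones spanned by consecutive units phi^(2k), phi^(2k+2) are unimodular over Z and cover the
    positive quadrant. The unit phi^(2k) brings the ratio of the conjugates into [1, phi^4), the
    range between 1 and phi^2; then a + b phi = (a - b) + b phi^2. The half-open interval makes s
    strictly positive. *)
Lemma inA_pos_decomp z1 z2 :
  inA z1 z2 -> 0 < z1 -> 0 < z2 ->
  exists k s t : Z, (1 <= s)%Z /\ (0 <= t)%Z /\
    z1 = P (2 * k) * (IZR s + IZR t * P 2) /\
    z2 = P (- (2 * k)) * (IZR s + IZR t * P (-2)).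
Proof.
  intros Hz H1 H2.
  destruct (powerRZ_floor (P 4) (z1 / z2)) as (k&Hk1&Hk2).
  { assert (H := P_lt 0 4); change (P 0) with 1 in H; apply H; lia. }
  { now apply Rdiv_lt_0_compat. }
  assert (E4 : forall j, powerRZ (P 4) j = P (2 * j) * P (2 * j)).
  { intros j; rewrite <- P_add; replace (2 * j + 2 * j)%Z with (4 * j)%Z by lia.
    assert (B := phi_bounds); rewrite powerRZ_Rpower by apply P_pos.
    rewrite !powerRZ_Rpower, Rpower_mult, mult_IZR by lra; reflexivity. }
  rewrite E4 in Hk1, Hk2.
  assert (Hw : inA (P (- (2 * k)) * z1) (P (2 * k) * z2)).
  { apply inA_mul; [apply inA_swap, inA_unit|assumption]. }
  destruct Hw as (a&b&Ea&Eb).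
  assert (Q := P_pos (2 * k)); assert (Q' := P_pos (- (2 * k))); assert (PN := P_mul_neg (2 * k)).
  set (c := P (2 * k)) in *; set (c' := P (- (2 * k))) in *.
  assert (Ec2 : P (2 * (k + 1)) = c * (phi + 1)).
  { replace (2 * (k + 1))%Z with (2 * k + 2)%Z by lia; rewrite P_add, P_2; reflexivity. }
  rewrite Ec2 in Hk2.
  assert (D : z1 / z2 * z2 = z1) by (field; lra).
  assert (K1 : c * c * z2 <= z1) by (rewrite <- D; apply Rmult_le_compat_r; lra).
  assert (K2 : z1 < c * (phi + 1) * (c * (phi + 1)) * z2)
    by (rewrite <- D at 1; apply Rmult_lt_compat_r; lra).
  assert (L1 : c * z2 <= c' * z1).
  { replace (c * z2) with (c' * (c * c * z2)) by (transitivity (c * c' * (c * z2)); [ring|rewrite PN; ring]).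
    apply Rmult_le_compat_l; lra. }
  assert (L2 : c' * z1 < (phi + 1) * (phi + 1) * (c * z2)).
  { replace ((phi + 1) * (phi + 1) * (c * z2)) with (c' * (c * (phi + 1) * (c * (phi + 1)) * z2))
      by (transitivity (c * c' * ((phi + 1) * (phi + 1) * (c * z2))); [ring|rewrite PN; ring]).
    apply Rmult_lt_compat_l; lra. }
  exists k, (a - b)%Z, b.
  assert (Hphi := phi_bounds); assert (E := phi_sq).
  rewrite Ea, Eb, psi_phi in L1, L2.
  assert (Hb : 0 <= IZR b) by nra.
  assert (Ha : 0 < IZR a - IZR b).
  { assert (X1 : (phi + 1) * (phi + 1) = 3 * phi + 2) by (ring [phi_sq]).
    rewrite X1 in L2.
    assert (X2 : (3 * phi + 2) * (IZR a + IZR b * (1 - phi)) =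
       3 * phi * IZR a + 2 * IZR a - 2 * phi * IZR b - IZR b) by (ring [phi_sq]).
    rewrite X2 in L2.
    assert (0 < (IZR a - IZR b) * (3 * phi + 1)) by lra.
    nra. }
  rewrite <- minus_IZR in Ha; apply lt_IZR in Ha; apply le_IZR in Hb.
  split; [lia|]; split; [lia|].
  rewrite minus_IZR, P_2, P_m2; fold c c'.
  split.
  - transitivity (c * c' * z1); [rewrite PN; ring|].
    rewrite Rmult_assoc, Ea; ring.
  - transitivity (c * c' * z2); [rewrite PN; ring|].
    replace (c * c' * z2) with (c' * (c * z2)) by ring.
    rewrite Eb, psi_phi; ring.
Qed.

(** * Places of [K] and totally positive units *)

(* [a = u + v sqrt p] with [u], [v] in [Q(sqrt 5)]; [U1], [U2] (resp. [V1], [V2]) are the two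
   real conjugates of [u] (resp. [v]). *)
Definition U1 (a : el) : R := e0 a + e1 a * sqrt 5.
Definition U2 (a : el) : R := e0 a - e1 a * sqrt 5.
Definition V1 (a : el) : R := e2 a + e3 a * sqrt 5.
Definition V2 (a : el) : R := e2 a - e3 a * sqrt 5.

Definition mk (u1 u2 v1 v2 : R) : el :=
  El ((u1 + u2) / 2) ((u1 - u2) / (2 * sqrt 5)) ((v1 + v2) / 2) ((v1 - v2) / (2 * sqrt 5)).

Lemma sqrt5_neq_0 : sqrt 5 <> 0.
Proof. assert (H := sqrt5_bounds); lra. Qed.

Lemma U1_mk u1 u2 v1 v2 : U1 (mk u1 u2 v1 v2) = u1.
Proof. unfold U1, mk; simpl; field; apply sqrt5_neq_0. Qed.
Lemma U2_mk u1 u2 v1 v2 : U2 (mk u1 u2 v1 v2) = u2.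
Proof. unfold U2, mk; simpl; field; apply sqrt5_neq_0. Qed.
Lemma V1_mk u1 u2 v1 v2 : V1 (mk u1 u2 v1 v2) = v1.
Proof. unfold V1, mk; simpl; field; apply sqrt5_neq_0. Qed.
Lemma V2_mk u1 u2 v1 v2 : V2 (mk u1 u2 v1 v2) = v2.
Proof. unfold V2, mk; simpl; field; apply sqrt5_neq_0. Qed.

Lemma mk_eta (a : el) : a = mk (U1 a) (U2 a) (V1 a) (V2 a).
Proof.
  apply El_ext; unfold U1, U2, V1, V2, mk; simpl; field; apply sqrt5_neq_0.
Qed.

Lemma UV_ext (a b : el) :
  U1 a = U1 b -> U2 a = U2 b -> V1 a = V1 b -> V2 a = V2 b -> a = b.
Proof. intros H1 H2 H3 H4; rewrite (mk_eta a), (mk_eta b), H1, H2, H3, H4; reflexivity. Qed.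

Lemma mk_mul (p : Z) u1 u2 v1 v2 w1 w2 z1 z2 :
  elmul p (mk u1 u2 v1 v2) (mk w1 w2 z1 z2) =
  mk (u1 * w1 + IZR p * (v1 * z1)) (u2 * w2 + IZR p * (v2 * z2))
     (u1 * z1 + v1 * w1) (u2 * z2 + v2 * w2).
Proof.
  assert (HU1 : forall a b, U1 (elmul p a b) = U1 a * U1 b + IZR p * (V1 a * V1 b))
    by (intros; unfold U1, V1, elmul; simpl; ring [sqrt5_sq]).
  assert (HU2 : forall a b, U2 (elmul p a b) = U2 a * U2 b + IZR p * (V2 a * V2 b))
    by (intros; unfold U2, V2, elmul; simpl; ring [sqrt5_sq]).
  assert (HV1 : forall a b, V1 (elmul p a b) = U1 a * V1 b + V1 a * U1 b)
    by (intros; unfold U1, V1, elmul; simpl; ring [sqrt5_sq]).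
  assert (HV2 : forall a b, V2 (elmul p a b) = U2 a * V2 b + V2 a * U2 b)
    by (intros; unfold U2, V2, elmul; simpl; ring [sqrt5_sq]).
  apply UV_ext; rewrite ?HU1, ?HU2, ?HV1, ?HV2, ?U1_mk, ?U2_mk, ?V1_mk, ?V2_mk; reflexivity.
Qed.

Lemma mk_add u1 u2 v1 v2 w1 w2 z1 z2 :
  eladd (mk u1 u2 v1 v2) (mk w1 w2 z1 z2) = mk (u1 + w1) (u2 + w2) (v1 + z1) (v2 + z2).
Proof. apply El_ext; unfold mk; simpl; field; apply sqrt5_neq_0. Qed.

Lemma mk_sub u1 u2 v1 v2 w1 w2 z1 z2 :
  elsub (mk u1 u2 v1 v2) (mk w1 w2 z1 z2) = mk (u1 - w1) (u2 - w2) (v1 - z1) (v2 - z2).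
Proof. apply El_ext; unfold mk; simpl; field; apply sqrt5_neq_0. Qed.

Lemma mk_conj u1 u2 v1 v2 : elconj true false (mk u1 u2 v1 v2) = mk u1 u2 (- v1) (- v2).
Proof. apply El_ext; unfold mk; simpl; field; apply sqrt5_neq_0. Qed.

Lemma mk_one : el1 = mk 1 1 0 0.
Proof. apply El_ext; unfold mk; simpl; field; apply sqrt5_neq_0. Qed.

Section Places.
Variable p : Z.
Hypothesis p_pos : (0 < p)%Z.
Hypothesis p_sqfree : Zsqfree p.
Hypothesis r_sqfree : Zsqfree (5 * p).
Hypothesis p_mod4 : (exists k, p = 4 * k + 3)%Z.
Add Ring el_ring_p4 : (el_ring_theory p).

Notation sp := (sqrt (IZR p)).

Lemma sp_pos : 0 < sp.
Proof. apply sqrt_lt_R0; now apply IZR_lt. Qed.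

Lemma sp_sq : sp * sp = IZR p.
Proof. apply sqrt_sqrt, IZR_le; lia. Qed.

Lemma sqrt_5p : sqrt (5 * IZR p) = sqrt 5 * sp.
Proof. apply sqrt_mult; [lra|apply IZR_le; lia]. Qed.

Lemma sigma_UV (s1 s2 : bool) (a : el) :
  sigma p s1 s2 a = (if s1 then U1 a else U2 a) + sg s2 * (if s1 then V1 a else V2 a) * sp.
Proof.
  unfold sigma, U1, U2, V1, V2; rewrite sqrt_5p; destruct s1, s2; simpl; ring.
Qed.

Lemma sigma_mul (s1 s2 : bool) (a b : el) :
  sigma p s1 s2 (elmul p a b) = sigma p s1 s2 a * sigma p s1 s2 b.
Proof.
  unfold sigma; rewrite sqrt_5p.
  assert (H5 := sqrt5_sq); assert (Hs := sp_sq).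
  destruct s1, s2; cbv [sg elmul e0 e1 e2 e3]; ring [H5 Hs].
Qed.

Lemma sigma_add (s1 s2 : bool) (a b : el) :
  sigma p s1 s2 (eladd a b) = sigma p s1 s2 a + sigma p s1 s2 b.
Proof. unfold sigma; simpl; ring. Qed.

Lemma sigma_one (s1 s2 : bool) : sigma p s1 s2 el1 = 1.
Proof. unfold sigma; simpl; ring. Qed.

Lemma sigma_conj (s1 s2 : bool) (a : el) :
  sigma p s1 s2 (elconj true false a) = sigma p s1 (negb s2) a.
Proof. unfold sigma; destruct s1, s2; simpl; ring. Qed.

Lemma in_OK_iff (a : el) : in_OK p a <-> inA (U1 a) (U2 a) /\ inA (V1 a) (V2 a).
Proof.
  split.
  - intros Ha; destruct (in_OK_form p a) as (x&y&z&t&->); try assumption.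
    split; [exists x, y|exists z, t]; unfold U1, U2, V1, V2, elZ, phi, psi; simpl; split; field.
  - intros ((x&y&E1&E2)&(z&t&E3&E4)).
    replace a with (elZ x y z t); [apply in_OK_elZ|].
    apply UV_ext; rewrite ?E1, ?E2, ?E3, ?E4; unfold U1, U2, V1, V2, elZ, phi, psi; simpl; field.
Qed.

Lemma in_OK_mk u1 u2 v1 v2 : inA u1 u2 -> inA v1 v2 -> in_OK p (mk u1 u2 v1 v2).
Proof. intros; apply in_OK_iff; rewrite U1_mk, U2_mk, V1_mk, V2_mk; now split. Qed.

Lemma in_OK_mul (a b : el) : in_OK p a -> in_OK p b -> in_OK p (elmul p a b).
Proof.
  intros [Ha Ha']%in_OK_iff [Hb Hb']%in_OK_iff.
  rewrite (mk_eta a), (mk_eta b), mk_mul; apply in_OK_mk; auto with ina.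
Qed.

Lemma in_OK_sub (a b : el) : in_OK p a -> in_OK p b -> in_OK p (elsub a b).
Proof.
  intros [Ha Ha']%in_OK_iff [Hb Hb']%in_OK_iff.
  rewrite (mk_eta a), (mk_eta b), mk_sub; apply in_OK_mk; auto with ina.
Qed.

Lemma in_OK_conj (a : el) : in_OK p a -> in_OK p (elconj true false a).
Proof.
  intros [Ha Ha']%in_OK_iff.
  rewrite (mk_eta a), mk_conj; apply in_OK_mk; auto with ina.
Qed.

Lemma totpos_iff (a : el) :
  totpos p a <-> in_OK p a /\
    (0 < U1 a + V1 a * sp /\ 0 < U1 a - V1 a * sp) /\
    (0 < U2 a + V2 a * sp /\ 0 < U2 a - V2 a * sp).
Proof.
  unfold totpos; split; intros [Ha H]; (split; [assumption|]).
  - assert (H1 := H true true); assert (H2 := H true false);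
    assert (H3 := H false true); assert (H4 := H false false).
    rewrite sigma_UV in H1, H2, H3, H4; simpl in H1, H2, H3, H4; lra.
  - intros [] []; rewrite sigma_UV; simpl; lra.
Qed.

Lemma totpos_mk u1 u2 v1 v2 :
  inA u1 u2 -> inA v1 v2 ->
  0 < u1 + v1 * sp -> 0 < u1 - v1 * sp -> 0 < u2 + v2 * sp -> 0 < u2 - v2 * sp ->
  totpos p (mk u1 u2 v1 v2).
Proof.
  intros; apply totpos_iff; rewrite U1_mk, U2_mk, V1_mk, V2_mk.
  split; [now apply in_OK_mk|tauto].
Qed.

Lemma totpos_mul (a b : el) : totpos p a -> totpos p b -> totpos p (elmul p a b).
Proof.
  intros [Ha Pa] [Hb Pb]; split; [now apply in_OK_mul|].
  intros; rewrite sigma_mul; now apply Rmult_lt_0_compat.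
Qed.

Lemma totpos_conj (a : el) : totpos p a -> totpos p (elconj true false a).
Proof.
  intros [Ha Pa]; split; [now apply in_OK_conj|].
  intros; rewrite sigma_conj; apply Pa.
Qed.

Lemma tp_unit_intro (e f : el) :
  totpos p e -> in_OK p f -> elmul p e f = el1 -> tp_unit p e.
Proof. intros He Hf Hef; split; [|assumption]; split; [apply He|now exists f]. Qed.

Lemma tp_unit_inv (e : el) :
  tp_unit p e -> exists f, tp_unit p f /\ elmul p e f = el1.
Proof.
  intros ((He&f&Hf&Hef)&Pe); exists f; split; [|assumption].
  apply tp_unit_intro with e; [|assumption|rewrite <- Hef; ring].
  split; [assumption|]; intros s1 s2.
  assert (H : sigma p s1 s2 e * sigma p s1 s2 f = 1) by (now rewrite <- sigma_mul, Hef, sigma_one).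
  assert (H' := proj2 Pe s1 s2); nra.
Qed.

Lemma tp_unit_mul (e f : el) : tp_unit p e -> tp_unit p f -> tp_unit p (elmul p e f).
Proof.
  intros He Hf.
  destruct (tp_unit_inv e He) as (e'&He'&Ee), (tp_unit_inv f Hf) as (f'&Hf'&Ef).
  apply tp_unit_intro with (elmul p e' f').
  - apply totpos_mul; [apply He|apply Hf].
  - apply in_OK_mul; [apply He'|apply Hf'].
  - transitivity (elmul p (elmul p e e') (elmul p f f')); [ring|rewrite Ee, Ef; ring].
Qed.

Lemma tp_unit_one : tp_unit p el1.
Proof.
  apply tp_unit_intro with el1; [|rewrite mk_one; apply in_OK_mk; apply inA_IZR|ring].
  split; [rewrite mk_one; apply in_OK_mk; apply inA_IZR|].
  intros; rewrite sigma_one; lra.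
Qed.

Lemma tp_unit_zpow (e : el) (k : Z) :
  tp_unit p e -> exists f, tp_unit p f /\
    forall s1 s2, sigma p s1 s2 f = powerRZ (sigma p s1 s2 e) k.
Proof.
  intros He.
  assert (Hnat : forall j : nat, exists f, tp_unit p f /\
    forall s1 s2, sigma p s1 s2 f = sigma p s1 s2 e ^ j).
  { induction j as [|j (f&Hf&IH)].
    - exists el1; split; [apply tp_unit_one|]; intros; rewrite sigma_one; reflexivity.
    - exists (elmul p e f); split; [now apply tp_unit_mul|].
      intros; rewrite sigma_mul, IH; reflexivity. }
  destruct (Hnat (Z.to_nat k)) as (f&Hf&Ef), (Hnat (Z.to_nat (- k))) as (g&Hg&Eg).
  destruct (Z_le_gt_dec 0 k) as [Hk|Hk].
  - exists f; split; [assumption|]; intros; rewrite Ef, pow_powerRZ, Z2Nat.id by lia; reflexivity.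
  - destruct (tp_unit_inv g Hg) as (h&Hh&Eh); exists h; split; [assumption|].
    intros s1 s2.
    assert (H : sigma p s1 s2 g * sigma p s1 s2 h = 1) by (now rewrite <- sigma_mul, Eh, sigma_one).
    rewrite Eg, pow_powerRZ, Z2Nat.id in H by lia.
    assert (P0 := proj2 (proj2 He) s1 s2).
    rewrite powerRZ_neg' in H.
    assert (Q := powerRZ_lt _ k P0).
    apply Rmult_eq_reg_l with (/ powerRZ (sigma p s1 s2 e) k).
    + rewrite H, Rinv_l by lra; reflexivity.
    + apply Rinv_neq_0_compat; lra.
Qed.

Lemma assoc_refl (a : el) : assoc p a a.
Proof. exists el1; split; [apply tp_unit_one|ring]. Qed.

Lemma assoc_sym (a b : el) : assoc p a b -> assoc p b a.
Proof.
  intros (e&He&->); destruct (tp_unit_inv e He) as (f&Hf&Ef).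
  exists f; split; [assumption|].
  transitivity (elmul p (elmul p e f) b); [rewrite Ef; ring|ring].
Qed.

Lemma assoc_trans (a b c : el) : assoc p a b -> assoc p b c -> assoc p a c.
Proof.
  intros (e&He&->) (f&Hf&->); exists (elmul p e f); split; [now apply tp_unit_mul|ring].
Qed.

Lemma assoc_mul (e a : el) : tp_unit p e -> assoc p (elmul p e a) a.
Proof. intros He; now exists e. Qed.

Lemma indec_unit_mul (e a : el) : tp_unit p e -> indec p a -> indec p (elmul p e a).
Proof.
  intros He [Pa Ha]; split; [apply totpos_mul; [apply He|assumption]|].
  destruct (tp_unit_inv e He) as (f&Hf&Ef).
  intros (b&c&Hb&Hc&E); apply Ha; exists (elmul p f b), (elmul p f c).
  split; [|split]; try (apply totpos_mul; [apply Hf|assumption]).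
  transitivity (elmul p f (elmul p e a)); [|rewrite E; ring].
  transitivity (elmul p (elmul p e f) a); [rewrite Ef; ring|ring].
Qed.

Lemma indec_assoc (a b : el) : assoc p a b -> indec p b -> indec p a.
Proof. intros (e&He&->); now apply indec_unit_mul. Qed.

Lemma indec_conj (a : el) : indec p a -> indec p (elconj true false a).
Proof.
  intros [Pa Ha]; split; [now apply totpos_conj|].
  intros (b&c&Hb&Hc&E); apply Ha; exists (elconj true false b), (elconj true false c).
  split; [|split]; try now apply totpos_conj.
  rewrite <- (elconj_invol true false a), E; apply elconj_add.
Qed.

(** This identifies indecomposables in both cones: it is enough to find a known totally positive b
    with a - b zero or totally positive. *)
Lemma indec_eq_of_sub (a b : el) :
  indec p a -> totpos p b -> (elsub a b = el0 \/ totpos p (elsub a b)) -> a = b.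
Proof.
  intros [Pa Ha] Hb [H|H].
  - transitivity (eladd (elsub a b) b); [ring|rewrite H; ring].
  - exfalso; apply Ha; exists b, (elsub a b); split; [|split]; try assumption; ring.
Qed.

Definition elnorm (a : el) : R :=
  sigma p true true a * sigma p true false a * (sigma p false true a * sigma p false false a).

Lemma elnorm_UV (a : el) :
  elnorm a = (U1 a * U1 a - IZR p * (V1 a * V1 a)) * (U2 a * U2 a - IZR p * (V2 a * V2 a)).
Proof.
  unfold elnorm; rewrite !sigma_UV; simpl; ring [sp_sq].
Qed.

Lemma elnorm_mul (a b : el) : elnorm (elmul p a b) = elnorm a * elnorm b.
Proof. unfold elnorm; rewrite !sigma_mul; ring. Qed.

Lemma elnorm_isZ (a : el) : in_OK p a -> isZ (elnorm a).
Proof.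
  intros [Ha Ha']%in_OK_iff; rewrite elnorm_UV; apply inA_norm; auto with ina.
Qed.

Lemma elnorm_totpos (a : el) : totpos p a -> 1 <= elnorm a.
Proof.
  intros [Ha Pa]; destruct (elnorm_isZ a Ha) as (z&Hz); rewrite Hz; apply IZR_le.
  assert (H : 0 < elnorm a) by (unfold elnorm; repeat apply Rmult_lt_0_compat; apply Pa).
  rewrite Hz in H; apply lt_IZR in H; lia.
Qed.

Lemma elnorm_tp_unit (e : el) : tp_unit p e -> elnorm e = 1.
Proof.
  intros He; destruct (tp_unit_inv e He) as (f&Hf&Ef).
  assert (H1 := elnorm_totpos e (proj2 He)); assert (H2 := elnorm_totpos f (proj2 Hf)).
  assert (H : elnorm e * elnorm f = 1).
  { rewrite <- elnorm_mul, Ef; unfold elnorm; rewrite !sigma_one; ring. }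
  nra.
Qed.

Lemma elnorm_assoc (a b : el) : assoc p a b -> elnorm a = elnorm b.
Proof. intros (e&He&->); rewrite elnorm_mul, (elnorm_tp_unit e He); ring. Qed.

(** If 1 = b + c, all conjugates of b lie in (0, 1), so its norm is below 1, against
    [elnorm_totpos]. *)
Lemma indec_one : indec p el1.
Proof.
  split; [apply tp_unit_one|]; intros (b&c&Hb&Hc&E).
  assert (H : forall s1 s2, 0 < sigma p s1 s2 b < 1).
  { intros s1 s2; assert (Pb := proj2 Hb s1 s2); assert (Pc := proj2 Hc s1 s2).
    assert (S := sigma_add s1 s2 b c); rewrite <- E, sigma_one in S; lra. }
  assert (N := elnorm_totpos b Hb); unfold elnorm in N.
  assert (H1 := H true true); assert (H2 := H true false);
  assert (H3 := H false true); assert (H4 := H false false).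
  assert (M : forall s t, 0 < s < 1 -> 0 < t < 1 -> 0 < s * t < 1) by (intros; nra).
  assert (M1 := M _ _ (M _ _ H1 H2) (M _ _ H3 H4)); lra.
Qed.

End Places.

Lemma ln_powerRZ (x : R) (k : Z) : 0 < x -> ln (powerRZ x k) = IZR k * ln x.
Proof. intros Hx; rewrite powerRZ_Rpower by assumption; apply ln_exp. Qed.

(** Translates of the square [0,E]^2 and of [0,G] x [-G,0] by the lattice generated by (E,E) and
    (G,-G) cover the plane. The difference u1 - u2 depends only on l, which puts it in [-G, G); then
    k puts the larger coordinate in [0, E). *)
Lemma square_cover (E G t1 t2 : R) :
  0 < E -> E <= G -> exists k l : Z,
  let u1 := t1 + IZR k * E + IZR l * G in
  let u2 := t2 + IZR k * E - IZR l * G in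
  (0 <= u1 <= E /\ 0 <= u2 <= E) \/ (0 <= u1 <= G /\ - G <= u2 <= 0).
Proof.
  intros HE HG.
  assert (Hfl : forall c t, 0 < c -> exists k : Z, 0 <= t + IZR k * c < c).
  { intros c t Hc; exists (- Int_part (t / c))%Z; rewrite opp_IZR.
    destruct (base_Int_part (t / c)) as [B1 B2].
    assert (Et : t = t / c * c) by (field; lra).
    set (i := IZR (Int_part (t / c))) in *; set (w := t / c) in *.
    rewrite Et; nra. }
  destruct (Hfl (2 * G) (t1 - t2 + G)) as (l&Hl); [lra|].
  destruct (Rle_dec 0 (t1 + IZR l * G - (t2 - IZR l * G))) as [H|H].
  - destruct (Hfl E (t1 + IZR l * G) HE) as (k&Hk).
    exists k, l; simpl.
    destruct (Rle_dec 0 (t2 + IZR k * E - IZR l * G)); [left|right]; lra.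
  - destruct (Hfl E (t2 - IZR l * G) HE) as (k&Hk).
    destruct (Rle_dec 0 (t1 + IZR k * E + IZR l * G)).
    + exists k, l; simpl; left; lra.
    (* Here u1 lies in [-G, 0) and u2 in [0, E). One more translation by (G,-G) reaches the second
       square because E <= G. *)
    + exists k, (l + 1)%Z; rewrite plus_IZR; simpl; right; lra.
Qed.

(** * Units and cones in the family *)

Section Family.
Variables (n : nat) (X Y p : Z).
Notation m := (12 * Z.of_nat n + 3)%Z.
Hypothesis HXY : IZR X + IZR Y * sqrt 5 = 2 * P m.
Hypothesis Hnorm : (X * X = 5 * (Y * Y) - 4)%Z.
Hypothesis Hp : (p = Y * Y - 1)%Z.
Hypothesis HX5 : (exists k, X + 1 = 5 * k)%Z.
Hypothesis HX4 : (4 <= X)%Z.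
Hypothesis HY2 : (2 <= Y)%Z.
Hypothesis p_sqfree : Zsqfree p.
Hypothesis r_sqfree : Zsqfree (5 * p).
Hypothesis p_mod4 : (exists k, p = 4 * k + 3)%Z.
Add Ring el_ring_p5 : (el_ring_theory p).

Lemma p_pos : (0 < p)%Z.
Proof. nia. Qed.

Let iOK := in_OK_iff p p_sqfree r_sqfree p_mod4.
Let OKmk := in_OK_mk p p_sqfree r_sqfree p_mod4.
Let sUV := sigma_UV p p_pos.

Notation sp := (sqrt (IZR p)).
Notation s5 := (sqrt 5).

Lemma X_phi : IZR X = P m - P (- m).
Proof.
  assert (Hp1 := P_mul_neg m); assert (Hp0 := P_pos m).
  assert (HN : IZR X * IZR X = 5 * (IZR Y * IZR Y) - 4)
    by (rewrite <- !mult_IZR, Hnorm, minus_IZR, !mult_IZR; ring).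
  assert (H5 := sqrt5_sq).
  assert (HQ : (IZR X - IZR Y * s5) * P m = -2).
  { apply Rmult_eq_reg_l with 2; [|lra].
    transitivity ((IZR X - IZR Y * s5) * (2 * P m)); [ring|rewrite <- HXY].
    transitivity (IZR X * IZR X - 5 * (IZR Y * IZR Y)); [ring [H5]|lra]. }
  assert (IZR X - IZR Y * s5 = - 2 * P (- m)).
  { apply Rmult_eq_reg_r with (P m); [|lra].
    rewrite HQ; transitivity (- 2 * (P m * P (- m))); [rewrite Hp1; ring|ring]. }
  lra.
Qed.

Lemma Y_phi : IZR Y * s5 = P m + P (- m).
Proof. assert (H := HXY); rewrite X_phi in H; lra. Qed.

Lemma XX_p : IZR X * IZR X = 5 * IZR p + 1.
Proof.
  rewrite Hp, minus_IZR, <- !mult_IZR, Hnorm, minus_IZR, !mult_IZR; ring.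
Qed.

Lemma YY_p : IZR Y * IZR Y = IZR p + 1.
Proof. rewrite Hp, minus_IZR, <- !mult_IZR; ring. Qed.

Lemma XR4 : 4 <= IZR X. Proof. now apply IZR_le. Qed.
Lemma YR2 : 2 <= IZR Y. Proof. now apply IZR_le. Qed.

Definition eps : R := IZR Y + sp.
Definition eta : R := IZR X + s5 * sp.

Lemma eps_inv : eps * (IZR Y - sp) = 1.
Proof.
  assert (H := sp_sq p p_pos); assert (HY := YY_p).
  unfold eps; transitivity (IZR Y * IZR Y - sp * sp); [ring|lra].
Qed.

Lemma eta_inv : eta * (IZR X - s5 * sp) = 1.
Proof.
  assert (H := sp_sq p p_pos); assert (HX := XX_p); assert (H5 := sqrt5_sq).
  unfold eta; transitivity (IZR X * IZR X - 5 * (sp * sp)); [ring [H5]|lra].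
Qed.

Lemma eps_gt : 2 < eps.
Proof. unfold eps; assert (H := sp_pos p p_pos); assert (H' := YR2); lra. Qed.

Lemma eta_gt : IZR X < eta.
Proof.
  unfold eta; assert (H := sp_pos p p_pos); assert (H5 := sqrt5_bounds); nra.
Qed.

Lemma eps_inv_pos : 0 < IZR Y - sp.
Proof. assert (H := eps_inv); assert (H' := eps_gt); nra. Qed.

Lemma eta_inv_pos : 0 < IZR X - s5 * sp.
Proof. assert (H := eta_inv); assert (H' := eta_gt); assert (H4 := XR4); nra. Qed.

Lemma eta_lt : eta < 2 * IZR X.
Proof. unfold eta; assert (H := eta_inv_pos); lra. Qed.

Lemma eps_le_eta : eps <= eta.
Proof.
  unfold eps, eta; assert (H := sp_pos p p_pos); assert (H5 := sqrt5_bounds).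
  assert (Y <= X)%Z by nia. assert (IZR Y <= IZR X) by (now apply IZR_le).
  nra.
Qed.

Definition el_eps : el := mk (IZR Y) (IZR Y) 1 1.
Definition el_eta : el := mk (IZR X) (IZR X) s5 (- s5).
Definition el_phi (k : Z) : el := mk (P (2 * k)) (P (- (2 * k))) 0 0.

Lemma inA_0 : inA 0 0. Proof. apply (inA_IZR 0). Qed.
Lemma inA_1 : inA 1 1. Proof. apply (inA_IZR 1). Qed.
#[local] Hint Resolve inA_0 inA_1 : ina.

Lemma sqrt5_opp : inA (- s5) s5.
Proof. apply inA_swap, inA_sqrt5. Qed.

Lemma tp_unit_eps : tp_unit p el_eps.
Proof.
  assert (H1 := eps_inv_pos); assert (H2 := eps_gt); unfold eps in H2.
  apply (tp_unit_intro p) with (mk (IZR Y) (IZR Y) (-1) (-1)).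
  - apply totpos_mk; auto using p_pos with ina; lra.
  - apply OKmk; auto with ina.
  - unfold el_eps; rewrite mk_mul, mk_one; assert (HY := YY_p); f_equal; lra.
Qed.

Lemma tp_unit_eta : tp_unit p el_eta.
Proof.
  assert (H1 := eta_inv_pos); assert (H2 := eta_gt); assert (H4 := XR4); unfold eta in H2.
  assert (H5 := sqrt5_sq).
  apply (tp_unit_intro p) with (mk (IZR X) (IZR X) (- s5) s5).
  - apply totpos_mk; auto using p_pos with ina; lra.
  - apply OKmk; auto using sqrt5_opp with ina.
  - unfold el_eta; rewrite mk_mul, mk_one; assert (HX := XX_p); f_equal; try lra.
    + replace (s5 * - s5) with (-5) by lra; lra.
    + replace (- s5 * s5) with (-5) by lra; lra.
Qed.

Lemma tp_unit_phi (k : Z) : tp_unit p (el_phi k).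
Proof.
  assert (H1 := P_pos (2 * k)); assert (H2 := P_pos (- (2 * k))); assert (H := P_mul_neg (2 * k)).
  apply (tp_unit_intro p) with (mk (P (- (2 * k))) (P (2 * k)) 0 0).
  - apply totpos_mk; auto using p_pos with ina; lra.
  - apply OKmk; auto with ina; apply inA_swap; auto with ina.
  - unfold el_phi; rewrite mk_mul, mk_one; f_equal; lra.
Qed.

(** * Reduction to the two cones by units *)

Lemma unit_lattice (k l : Z) : exists e, tp_unit p e /\
  forall s1 s2, ln (sigma p s1 s2 e) = sg s2 * (IZR k * ln eps + sg s1 * (IZR l * ln eta)).
Proof.
  destruct (tp_unit_zpow p p_pos p_sqfree r_sqfree p_mod4 _ k tp_unit_eps) as (e&He&Ee).
  destruct (tp_unit_zpow p p_pos p_sqfree r_sqfree p_mod4 _ l tp_unit_eta) as (f&Hf&Ef).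
  exists (elmul p e f); split; [apply tp_unit_mul; auto using p_pos|].
  intros s1 s2; rewrite (sigma_mul p p_pos), Ee, Ef.
  assert (Pe := proj2 (proj2 tp_unit_eps) s1 s2).
  assert (Pf := proj2 (proj2 tp_unit_eta) s1 s2).
  rewrite ln_mult by (now apply powerRZ_lt).
  rewrite !ln_powerRZ by assumption.
  assert (Ie : IZR Y - sp = / eps).
  { assert (H := eps_inv); assert (H' := eps_gt); apply Rmult_eq_reg_l with eps; [|lra].
    rewrite H, Rinv_r; lra. }
  assert (If : IZR X - s5 * sp = / eta).
  { assert (H := eta_inv); assert (H' := eta_gt); assert (H4 := XR4).
    apply Rmult_eq_reg_l with eta; [|lra]. rewrite H, Rinv_r; lra. }
  assert (Le : ln (sigma p s1 s2 el_eps) = sg s2 * ln eps).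
  { rewrite sUV; unfold el_eps; rewrite U1_mk, U2_mk, V1_mk, V2_mk.
    assert (H := eps_gt).
    destruct s1, s2; simpl.
    1, 3: replace (IZR Y + 1 * 1 * sp) with eps by (unfold eps; ring); ring.
    all: replace (IZR Y + -1 * 1 * sp) with (/ eps) by (rewrite <- Ie; ring);
      rewrite ln_Rinv by lra; ring. }
  assert (Lf : ln (sigma p s1 s2 el_eta) = sg s2 * sg s1 * ln eta).
  { rewrite sUV; unfold el_eta; rewrite U1_mk, U2_mk, V1_mk, V2_mk.
    assert (H := eta_gt); assert (H4 := XR4).
    destruct s1, s2; simpl.
    - replace (IZR X + 1 * s5 * sp) with eta by (unfold eta; ring); ring.
    - replace (IZR X + -1 * s5 * sp) with (/ eta) by (rewrite <- If; ring);
      rewrite ln_Rinv by lra; ring.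
    - replace (IZR X + 1 * - s5 * sp) with (/ eta) by (rewrite <- If; ring);
      rewrite ln_Rinv by lra; ring.
    - replace (IZR X + -1 * - s5 * sp) with eta by (unfold eta; ring); ring. }
  rewrite Le, Lf; ring.
Qed.

(** At a place of Q(sqrt 5), the cone of 1 and [eps] is the set of ratios from 1 to eps^2; this is
    [square_cover] for logarithms, with E and G doubled. In the [eta] case the order is reversed at
    the second place, where sqrt 5 changes sign and [eta] becomes 1/eta. *)
Lemma unit_reduction (a : el) : totpos p a -> exists b, assoc p a b /\ totpos p b /\
  let s11 := sigma p true true b in let s10 := sigma p true false b in
  let s01 := sigma p false true b in let s00 := sigma p false false b in
  (s10 <= s11 <= eps * eps * s10 /\ s00 <= s01 <= eps * eps * s00) \/
  (s10 <= s11 <= eta * eta * s10 /\ s01 <= s00 <= eta * eta * s01).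
Proof.
  intros Ha.
  set (t1 := ln (sigma p true true a) - ln (sigma p true false a)).
  set (t2 := ln (sigma p false true a) - ln (sigma p false false a)).
  assert (Lle : ln eps <= ln eta).
  { destruct eps_le_eta as [H|H]; [left; apply ln_increasing; [assert (He := eps_gt); lra|assumption]
      |right; now rewrite H]. }
  assert (Lpos : 0 < ln eps) by (rewrite <- ln_1; apply ln_increasing; assert (He := eps_gt); lra).
  destruct (square_cover (2 * ln eps) (2 * ln eta) t1 t2) as (k&l&Hkl); [lra|lra|].
  destruct (unit_lattice k l) as (e&He&Ee).
  exists (elmul p e a); split; [apply assoc_sym, assoc_mul; auto using p_pos|].
  assert (Pb : totpos p (elmul p e a)) by (apply totpos_mul; auto using p_pos; apply He).
  split; [assumption|].
  assert (Le : forall s1 s2, ln (sigma p s1 s2 (elmul p e a)) =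
    ln (sigma p s1 s2 a) + sg s2 * (IZR k * ln eps + sg s1 * (IZR l * ln eta))).
  { intros s1 s2; rewrite (sigma_mul p p_pos), ln_mult, Ee;
      [ring|apply (proj2 (proj2 He))|apply (proj2 Ha)]. }
  assert (B := proj2 Pb).
  set (b := elmul p e a) in *.
  assert (Hle : forall x y, 0 < x -> 0 < y -> ln x <= ln y -> x <= y).
  { intros x y Hx Hy [H|H]; [left; now apply ln_lt_inv|right; now apply ln_inv]. }
  assert (He0 := eps_gt); assert (Hf0 := eta_gt); assert (HX4' := XR4).
  assert (Hee : forall c x, 0 < c -> 0 < x -> ln (c * c * x) = 2 * ln c + ln x).
  { intros; rewrite !ln_mult; [ring|lra..|nra|lra]. }
  assert (Hpp : forall c x, 0 < c -> 0 < x -> 0 < c * c * x)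
    by (intros; repeat apply Rmult_lt_0_compat; assumption).
  assert (L11 := Le true true); assert (L10 := Le true false);
  assert (L01 := Le false true); assert (L00 := Le false false); simpl in L11, L10, L01, L00.
  assert (B11 := B true true); assert (B10 := B true false);
  assert (B01 := B false true); assert (B00 := B false false).
  unfold t1, t2 in Hkl; simpl in Hkl.
  destruct Hkl as [Hkl|Hkl]; [left|right];
    split; split; apply Hle; try (apply Hpp); try assumption; try lra; rewrite ?Hee; lra.
Qed.

Lemma sigma_zero (a : el) : (forall s1 s2, sigma p s1 s2 a = 0) -> a = el0.
Proof.
  intros H.
  assert (H1 := H true true); assert (H2 := H true false);
  assert (H3 := H false true); assert (H4 := H false false).
  rewrite sUV in H1, H2, H3, H4; simpl in H1, H2, H3, H4; assert (S := sp_pos p p_pos).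
  apply UV_ext; [| | apply Rmult_eq_reg_r with sp; [|lra] | apply Rmult_eq_reg_r with sp; [|lra] ];
    transitivity 0; try lra; unfold U1, U2, V1, V2; simpl; ring.
Qed.

(** Cone coordinates are conjugate to each other, so a coordinate that vanishes at one place
    vanishes at both. Hence an integer in the closed cones cannot be zero at one place and positive
    at the other. *)
Lemma cone_zero_or_totpos (a : el) (x y : bool -> R) (w : bool -> bool -> R) :
  in_OK p a ->
  (forall s1 s2, sigma p s1 s2 a = x s1 + y s1 * w s1 s2) ->
  (forall s1 s2, 0 < w s1 s2) -> (forall s, 0 <= x s) -> (forall s, 0 <= y s) ->
  (x true = 0 <-> x false = 0) -> (y true = 0 <-> y false = 0) ->
  a = el0 \/ totpos p a.
Proof.
  intros Ha Hs Hw Hx Hy [X1 X2] [Y1 Y2].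
  assert (Hyw : forall s1 s2, 0 <= y s1 * w s1 s2)
    by (intros; apply Rmult_le_pos; [apply Hy|left; apply Hw]).
  destruct (Req_dec (x true) 0) as [Ex|Ex].
  - destruct (Req_dec (y true) 0) as [Ey|Ey].
    + left; apply sigma_zero; intros s1 s2; rewrite Hs.
      specialize (X1 Ex); specialize (Y1 Ey).
      destruct s1; [rewrite Ex, Ey|rewrite X1, Y1]; ring.
    + right; split; [assumption|]; intros s1 s2; rewrite Hs.
      assert (0 < y s1).
      { assert (H := Hy s1); destruct H as [H|H]; [assumption|].
        destruct s1; symmetry in H; tauto. }
      assert (H0 := Hx s1); assert (H1 := Rmult_lt_0_compat _ _ H (Hw s1 s2)); lra.
  - right; split; [assumption|]; intros s1 s2; rewrite Hs.
    assert (0 < x s1).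
    { assert (H := Hx s1); destruct H as [H|H]; [assumption|].
      destruct s1; symmetry in H; tauto. }
    assert (H0 := Hyw s1 s2); lra.
Qed.

(** * Indecomposables in the two cones *)

Lemma inA_pos_unit z1 z2 : inA z1 z2 -> 0 < z1 -> 0 < z2 ->
  exists k, P (2 * k) <= z1 /\ P (- (2 * k)) <= z2.
Proof.
  intros Hz H1 H2; destruct (inA_pos_decomp z1 z2 Hz H1 H2) as (k&s&t&Hs&Ht&E1&E2).
  exists k; rewrite E1, E2.
  apply IZR_le in Hs; apply IZR_le in Ht.
  assert (A := P_pos (2 * k)); assert (B := P_pos (- (2 * k)));
  assert (C := P_pos 2); assert (D := P_pos (-2)).
  split; rewrite <- (Rmult_1_r (P _)) at 1; apply Rmult_le_compat_l; try lra;
    apply Rle_trans with (IZR s); nra.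
Qed.

Lemma inA_nonneg_cases z1 z2 : inA z1 z2 -> 0 <= z1 -> 0 <= z2 ->
  (z1 = 0 /\ z2 = 0) \/ (0 < z1 /\ 0 < z2).
Proof.
  intros Hz [H1|H1] [H2|H2]; [now right| | |now left].
  - exfalso; symmetry in H2; apply (inA_zero_r _ _ Hz) in H2; lra.
  - exfalso; symmetry in H1; apply (inA_zero _ _ Hz) in H1; lra.
Qed.

Lemma inA_zero_iff z1 z2 : inA z1 z2 -> (z1 = 0 <-> z2 = 0).
Proof. intros H; split; [apply (inA_zero _ _ H)|apply (inA_zero_r _ _ H)]. Qed.

(* [cone (1, eps)] is unimodular at both places. *)
Lemma indec_eps_cone (a : el) : indec p a ->
  let s11 := sigma p true true a in let s10 := sigma p true false a in
  let s01 := sigma p false true a in let s00 := sigma p false false a in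
  s10 <= s11 <= eps * eps * s10 /\ s00 <= s01 <= eps * eps * s00 ->
  assoc p a el1.
Proof.
  intros Ha; simpl; intros Hc.
  destruct (proj1 (iOK a) (proj1 (proj1 Ha))) as [HU HV].
  rewrite !sUV in Hc; simpl in Hc.
  set (b1 := V1 a) in *; set (b2 := V2 a) in *.
  set (a1 := U1 a - IZR Y * b1); set (a2 := U2 a - IZR Y * b2).
  assert (E1 : U1 a = a1 + IZR Y * b1) by (unfold a1; ring).
  assert (E2 : U2 a = a2 + IZR Y * b2) by (unfold a2; ring).
  assert (HA : inA a1 a2) by (unfold a1, a2; auto with ina).
  rewrite E1, E2 in Hc.
  assert (S := sp_pos p p_pos); assert (EI := eps_inv); assert (EG := eps_gt).
  assert (EP := eps_inv_pos).
  (* The ratio bounds are the signs of the cone coordinates: the lower one gives 0 <= b, and the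
     upper one, through eps (Y - sqrt p) = 1, reduces to 0 <= (eps^2 - 1) c. *)
  assert (Hnn : forall c b, c + IZR Y * b + -1 * b * sp <= c + IZR Y * b + 1 * b * sp <=
       eps * eps * (c + IZR Y * b + -1 * b * sp) -> 0 <= c /\ 0 <= b).
  { intros c b [L1 L2]; split; [|apply Rmult_le_reg_r with sp; lra].
    replace (c + IZR Y * b + 1 * b * sp) with (c + b * eps) in L2 by (unfold eps; ring).
    replace (eps * eps * (c + IZR Y * b + -1 * b * sp)) with
      (eps * eps * c + eps * b * (eps * (IZR Y - sp))) in L2 by ring.
    rewrite EI in L2.
    assert (1 < eps * eps) by nra.
    apply Rmult_le_reg_l with (eps * eps - 1); lra. }
  destruct Hc as [Hc1 Hc2].
  destruct (Hnn _ _ Hc1) as [N1 N2], (Hnn _ _ Hc2) as [N3 N4].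
  assert (Hsub : forall c1 c2 d1 d2 : R, inA c1 c2 -> inA d1 d2 ->
     0 <= c1 -> 0 <= c2 -> 0 <= d1 -> 0 <= d2 ->
     let g := mk (c1 + IZR Y * d1) (c2 + IZR Y * d2) d1 d2 in g = el0 \/ totpos p g).
  { intros c1 c2 d1 d2 Hc Hd P1 P2 P3 P4; simpl.
    apply (cone_zero_or_totpos _ (fun s => if s then c1 else c2) (fun s => if s then d1 else d2)
      (fun s1 s2 => if s2 then eps else IZR Y - sp)).
    - apply OKmk; auto with ina.
    - intros s1 s2; rewrite sUV, U1_mk, U2_mk, V1_mk, V2_mk; unfold eps; destruct s1, s2; simpl; ring.
    - intros s1 []; lra.
    - intros []; assumption.
    - intros []; assumption.
    - now apply inA_zero_iff.
    - now apply inA_zero_iff. }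
  assert (Eta : a = mk (a1 + IZR Y * b1) (a2 + IZR Y * b2) b1 b2).
  { rewrite (mk_eta a), E1, E2; reflexivity. }
  destruct (inA_nonneg_cases a1 a2 HA N1 N3) as [[Z1 Z2]|[Q1 Q2]].
  - destruct (inA_nonneg_cases b1 b2 HV N2 N4) as [[Z3 Z4]|[Q3 Q4]].
    + exfalso; assert (T := proj2 (proj1 Ha) true true); rewrite sUV in T; simpl in T.
      fold b1 in T; rewrite E1, Z1, Z3 in T; lra.
    + destruct (inA_pos_unit b1 b2 HV Q3 Q4) as (k&K1&K2).
      assert (Ea : a = elmul p (elmul p (el_phi k) el_eps) el1).
      { replace (elmul p (elmul p (el_phi k) el_eps) el1) with (elmul p (el_phi k) el_eps) by ring.
        apply (indec_eq_of_sub p); [assumption|apply totpos_mul; auto using p_pos|].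
        - apply tp_unit_phi.
        - apply tp_unit_eps.
        - unfold el_phi, el_eps; rewrite mk_mul, Eta, mk_sub.
          replace (mk _ _ _ _) with (mk (0 + IZR Y * (b1 - P (2 * k))) (0 + IZR Y * (b2 - P (- (2 * k))))
             (b1 - P (2 * k)) (b2 - P (- (2 * k)))) by (f_equal; rewrite ?Z1, ?Z2; ring).
          apply Hsub; auto with ina; lra. }
      exists (elmul p (el_phi k) el_eps); split; [|assumption].
      apply tp_unit_mul; auto using p_pos, tp_unit_phi, tp_unit_eps.
  - destruct (inA_pos_unit a1 a2 HA Q1 Q2) as (k&K1&K2).
    assert (Ea : a = elmul p (el_phi k) el1).
    { replace (elmul p (el_phi k) el1) with (el_phi k) by ring.
      apply (indec_eq_of_sub p); [assumption|apply tp_unit_phi|].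
      unfold el_phi; rewrite Eta, mk_sub.
      replace (mk _ _ _ _) with (mk (a1 - P (2 * k) + IZR Y * b1) (a2 - P (- (2 * k)) + IZR Y * b2)
             b1 b2) by (f_equal; ring).
      apply Hsub; auto with ina; lra. }
    exists (el_phi k); split; [apply tp_unit_phi|assumption].
Qed.

(** The conjugates of 1/(sqrt 5 phi). The factor 1/phi corrects the mixed signs of 1/sqrt 5, so this
    is a totally positive generator of A/sqrt 5. *)
Definition tau1 : R := (phi - 1) / s5.
Definition tau2 : R := phi / s5.

Lemma tau1_pos : 0 < tau1.
Proof. assert (H := phi_bounds); assert (H5 := sqrt5_bounds); apply Rdiv_lt_0_compat; lra. Qed.

Lemma tau2_pos : 0 < tau2.
Proof. assert (H := phi_bounds); assert (H5 := sqrt5_bounds); apply Rdiv_lt_0_compat; lra. Qed.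

Lemma tau_norm : tau1 * tau2 = / 5.
Proof.
  assert (H := sqrt5_neq_0); apply Rmult_eq_reg_r with (s5 * s5); [|rewrite sqrt5_sq; lra].
  transitivity ((phi - 1) * phi); [unfold tau1, tau2; field; assumption|].
  rewrite sqrt5_sq; transitivity 1; [ring [phi_sq]|field].
Qed.

(* [lam + mu * eta] with [lam = (l1, l2)] and [mu = (m1, m2)] at the two places of [Q(sqrt 5)];
   note that [eta] becomes [1 / eta] at the second place. *)
Definition LM (l1 l2 m1 m2 : R) : el :=
  mk (l1 + m1 * IZR X) (l2 + m2 * IZR X) (m1 * s5) (- (m2 * s5)).

Lemma sigma_LM l1 l2 m1 m2 (s1 s2 : bool) :
  sigma p s1 s2 (LM l1 l2 m1 m2) =
  (if s1 then l1 else l2) + (if s1 then m1 else m2) *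
     (if Bool.eqb s1 s2 then eta else IZR X - s5 * sp).
Proof.
  unfold LM; rewrite sUV, U1_mk, U2_mk, V1_mk, V2_mk; unfold eta; destruct s1, s2; simpl; ring.
Qed.

Lemma LM_sub l1 l2 m1 m2 l1' l2' m1' m2' :
  elsub (LM l1 l2 m1 m2) (LM l1' l2' m1' m2') = LM (l1 - l1') (l2 - l2') (m1 - m1') (m2 - m2').
Proof. unfold LM; rewrite mk_sub; f_equal; ring. Qed.

Lemma LM_phi l1 l2 m1 m2 k :
  elmul p (el_phi k) (LM l1 l2 m1 m2) =
  LM (P (2 * k) * l1) (P (- (2 * k)) * l2) (P (2 * k) * m1) (P (- (2 * k)) * m2).
Proof. unfold LM, el_phi; rewrite mk_mul; f_equal; ring. Qed.

Lemma el_as_LM (a : el) :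
  a = LM (U1 a - V1 a / s5 * IZR X) (U2 a + V2 a / s5 * IZR X) (V1 a / s5) (- (V2 a / s5)).
Proof. rewrite (mk_eta a) at 1; unfold LM; assert (H := sqrt5_neq_0); f_equal; field; assumption. Qed.

(** Integrality puts lam + mu X and sqrt 5 mu in A. As X + 1 is a multiple of 5, mu (X + 1) lies in
    A too, and lam - mu = (lam + mu X) - mu (X + 1). *)
Lemma in_OK_LM l1 l2 m1 m2 : in_OK p (LM l1 l2 m1 m2) ->
  inA (s5 * l1) (- s5 * l2) /\ inA (s5 * m1) (- s5 * m2) /\ inA (l1 - m1) (l2 - m2).
Proof.
  intros [HU HV]%iOK; unfold LM in HU, HV; rewrite U1_mk, U2_mk in HU; rewrite V1_mk, V2_mk in HV.
  destruct HX5 as (k&Hk).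
  assert (Hk' : IZR X = 5 * IZR k - 1) by (apply (f_equal IZR) in Hk; rewrite plus_IZR, mult_IZR in Hk; lra).
  split; [|split].
  - replace (s5 * l1) with (s5 * (l1 + m1 * IZR X) - m1 * s5 * IZR X) by ring.
    replace (- s5 * l2) with (- s5 * (l2 + m2 * IZR X) - - (m2 * s5) * IZR X) by ring.
    auto with ina.
  - replace (s5 * m1) with (m1 * s5) by ring.
    replace (- s5 * m2) with (- (m2 * s5)) by ring; assumption.
  - replace (l1 - m1) with (l1 + m1 * IZR X - IZR k * (s5 * (m1 * s5)))
      by (rewrite Hk'; ring [sqrt5_sq]).
    replace (l2 - m2) with (l2 + m2 * IZR X - IZR k * (- s5 * - (m2 * s5)))
      by (rewrite Hk'; ring [sqrt5_sq]).
    auto with ina.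
Qed.

Lemma inA_sqrt5_zero_iff z1 z2 : inA (s5 * z1) (- s5 * z2) -> (z1 = 0 <-> z2 = 0).
Proof.
  intros H; assert (H5 := sqrt5_neq_0); assert (H' := inA_zero_iff _ _ H).
  split; intros Hz; rewrite Hz in H'.
  - apply Rmult_eq_reg_l with (- s5); [rewrite Rmult_0_r; apply H'; ring|lra].
  - apply Rmult_eq_reg_l with s5; [rewrite Rmult_0_r; apply H'; ring|lra].
Qed.

Lemma LM_cone l1 l2 m1 m2 : in_OK p (LM l1 l2 m1 m2) ->
  0 <= l1 -> 0 <= l2 -> 0 <= m1 -> 0 <= m2 ->
  LM l1 l2 m1 m2 = el0 \/ totpos p (LM l1 l2 m1 m2).
Proof.
  intros H L1 L2 M1 M2; destruct (in_OK_LM _ _ _ _ H) as (Hl&Hm&_).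
  assert (E1 := eta_gt); assert (E2 := eta_inv_pos); assert (X4 := XR4).
  apply (cone_zero_or_totpos _ (fun s => if s then l1 else l2) (fun s => if s then m1 else m2)
      (fun s1 s2 => if Bool.eqb s1 s2 then eta else IZR X - s5 * sp)); try assumption.
  - intros; apply sigma_LM.
  - intros s1 s2; destruct (Bool.eqb s1 s2); lra.
  - intros []; assumption.
  - intros []; assumption.
  - now apply inA_sqrt5_zero_iff.
  - now apply inA_sqrt5_zero_iff.
Qed.

(** The congruence phi^(2k) = 1 modulo sqrt 5; the sign in the second coordinate is that of the
    conjugate of sqrt 5. *)
Definition cong1 (k : Z) : Prop := inA ((P (2 * k) - 1) / s5) (- ((P (- (2 * k)) - 1) / s5)).

(* [phi^4 = 1 mod sqrt 5] *)
Lemma phi4_cong (i : Z) : cong1 (2 * i).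
Proof.
  assert (Hs : forall k, cong1 k -> cong1 (k + 2)).
  { intros k Hk; unfold cong1 in *.
    replace (2 * (k + 2))%Z with (2 * k + 4)%Z by lia.
    replace (- (2 * k + 4))%Z with (- (2 * k) + -4)%Z by lia.
    rewrite !P_add.
    assert (E4 : P 4 = 3 * phi + 2).
    { change 4%Z with (2 + 2)%Z; rewrite P_add, P_2; ring [phi_sq]. }
    assert (E4' : P (-4) = 5 - 3 * phi).
    { change (-4)%Z with (-2 + -2)%Z; rewrite P_add, P_m2; ring [phi_sq]. }
    replace ((P (2 * k) * P 4 - 1) / s5) with
      (P 4 * ((P (2 * k) - 1) / s5) + (P 4 - 1) / s5) by (field; apply sqrt5_neq_0).
    replace (- ((P (- (2 * k)) * P (-4) - 1) / s5)) with
      (P (-4) * (- ((P (- (2 * k)) - 1) / s5)) + (- ((P (-4) - 1) / s5))) by (field; apply sqrt5_neq_0).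
    apply inA_add; [apply inA_mul; [apply (inA_unit 2)|assumption]|].
    exists 1%Z, 1%Z; rewrite E4, E4', psi_phi.
    assert (H := sqrt5_neq_0); assert (H5 := sqrt5_sq).
    split; apply Rmult_eq_reg_r with s5; try assumption; field_simplify; try assumption;
      rewrite sqrt5_phi; ring [phi_sq]. }
  assert (Hneg : forall k, cong1 k -> cong1 (- k)).
  { intros k Hk; unfold cong1 in *.
    replace (2 * - k)%Z with (- (2 * k))%Z by lia; rewrite Z.opp_involutive.
    apply inA_swap, inA_opp in Hk; rewrite Ropp_involutive in Hk; assumption. }
  assert (Hn : forall j : nat, cong1 (2 * Z.of_nat j)).
  { induction j as [|j IH].
    - unfold cong1; simpl; replace ((1 - 1) / s5) with 0 by (field; apply sqrt5_neq_0).
      rewrite Ropp_0; apply inA_0.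
    - replace (2 * Z.of_nat (S j))%Z with (2 * Z.of_nat j + 2)%Z by lia; auto. }
  destruct (Z_le_gt_dec 0 i) as [Hi|Hi].
  - rewrite <- (Z2Nat.id i) by lia; apply Hn.
  - replace (2 * i)%Z with (- (2 * Z.of_nat (Z.to_nat (- i))))%Z by (rewrite Z2Nat.id; lia).
    auto.
Qed.

Definition delta (i : Z) : el :=
  LM tau1 tau2 (tau1 * P (2 * (2 * i))) (tau2 * P (- (2 * (2 * i)))).

(** With phi^(4i) = 1 and X = -1 modulo sqrt 5, the element 1 + phi^(4i) X is divisible by sqrt 5,
    which absorbs the denominator of tau. *)
Lemma in_OK_delta (i : Z) : in_OK p (delta i).
Proof.
  destruct HX5 as (k&Hk).
  assert (Hk' : IZR X + 1 = 5 * IZR k) by (apply (f_equal IZR) in Hk; rewrite plus_IZR, mult_IZR in Hk; lra).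
  assert (H5 := sqrt5_neq_0); assert (Hsq := sqrt5_sq).
  assert (C := phi4_cong i); unfold cong1 in C.
  set (q := P (2 * (2 * i))) in *; set (q' := P (- (2 * (2 * i)))) in *.
  assert (Hq : inA q q') by (unfold q, q'; auto with ina).
  unfold delta, LM; fold q q'.
  assert (T1 : tau1 * s5 = phi - 1) by (unfold tau1; field; assumption).
  assert (T2 : tau2 * s5 = phi) by (unfold tau2; field; assumption).
  apply OKmk.
  - replace (tau1 + tau1 * q * IZR X) with
      (IZR k * (s5 * (phi - 1)) + (phi - 1) * IZR X * ((q - 1) / s5)).
    2:{ transitivity (tau1 * (IZR X + 1) + tau1 * IZR X * (q - 1)); [|ring].
        rewrite Hk'; replace (q - 1) with (s5 * ((q - 1) / s5)) at 2 by (field; assumption).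
        rewrite <- T1; ring [Hsq]. }
    replace (tau2 + tau2 * q' * IZR X) with
      (IZR k * (- s5 * (psi - 1)) + (psi - 1) * IZR X * (- ((q' - 1) / s5))).
    2:{ transitivity (tau2 * (IZR X + 1) + tau2 * IZR X * (q' - 1)); [|ring].
        rewrite psi_phi, Hk'; replace (1 - phi - 1) with (- (tau2 * s5)) by lra.
        replace (q' - 1) with (s5 * ((q' - 1) / s5)) at 2 by (field; assumption).
        ring [Hsq]. }
    auto 10 with ina.
  - replace (tau1 * q * s5) with ((phi - 1) * q) by (rewrite <- T1; ring).
    replace (- (tau2 * q' * s5)) with ((psi - 1) * q')
      by (rewrite psi_phi; replace (1 - phi - 1) with (- (tau2 * s5)) by lra; ring).
    auto with ina.
Qed.

Lemma totpos_delta (i : Z) : totpos p (delta i).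
Proof.
  split; [apply in_OK_delta|]; intros s1 s2; unfold delta; rewrite sigma_LM.
  assert (H1 := tau1_pos); assert (H2 := tau2_pos); assert (E1 := eta_gt); assert (E2 := eta_inv_pos).
  assert (X4 := XR4); assert (Q1 := P_pos (2 * (2 * i))); assert (Q2 := P_pos (- (2 * (2 * i)))).
  assert (W : 0 < (if Bool.eqb s1 s2 then eta else IZR X - s5 * sp))
    by (destruct (Bool.eqb s1 s2); lra).
  destruct s1; cbv iota; apply Rplus_lt_0_compat; try assumption;
    apply Rmult_lt_0_compat; try assumption; apply Rmult_lt_0_compat; assumption.
Qed.

(** Dominating two consecutive units lets the parity of the exponent be chosen later; only s
    phi^(2k) with s = 1 or 2 lacks this freedom. *)
Lemma inA_pos_two_units z1 z2 : inA z1 z2 -> 0 < z1 -> 0 < z2 ->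
  exists k, P (2 * k) <= z1 /\ P (- (2 * k)) <= z2 /\
   ((P (2 * (k + 1)) <= z1 /\ P (- (2 * (k + 1))) <= z2) \/
    exists s : Z, (1 <= s <= 2)%Z /\ z1 = IZR s * P (2 * k) /\ z2 = IZR s * P (- (2 * k))).
Proof.
  intros Hz H1 H2; destruct (inA_pos_decomp z1 z2 Hz H1 H2) as (k&s&t&Hs&Ht&E1&E2).
  exists k; rewrite E1, E2.
  replace (2 * (k + 1))%Z with (2 * k + 2)%Z by lia.
  replace (- (2 * k + 2))%Z with (- (2 * k) + -2)%Z by lia.
  rewrite !P_add, P_2, P_m2; assert (B := phi_bounds).
  assert (Hs' := IZR_le _ _ Hs); assert (Ht' := IZR_le _ _ Ht).
  assert (A1 := P_pos (2 * k)); assert (A2 := P_pos (- (2 * k))).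
  set (c := P (2 * k)) in *; set (c' := P (- (2 * k))) in *.
  split; [|split].
  - rewrite <- (Rmult_1_r c) at 1; apply Rmult_le_compat_l; nra.
  - rewrite <- (Rmult_1_r c') at 1; apply Rmult_le_compat_l; nra.
  - destruct (Z_le_gt_dec 1 t) as [Ht1|Ht1].
    { left; apply IZR_le in Ht1; split; apply Rmult_le_compat_l; nra. }
    assert (t = 0)%Z by lia; subst t.
    (* 3 = phi^2 + phi^(-2) exceeds phi^2 at both places. *)
    destruct (Z_le_gt_dec 3 s) as [Hs3|Hs3].
    { left; apply IZR_le in Hs3; split; apply Rmult_le_compat_l; lra. }
    right; exists s; split; [lia|]; split; ring.
Qed.

(* If both [nu] and [nu'] are at most two copies of units of opposite parities [k], [l], then
   [nu = nu'] modulo [sqrt 5] would force [s + s' = 0 mod 5] with [s, s' <= 2]. *)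
Lemma parity_units z1 z2 w1 w2 :
  inA z1 z2 -> 0 < z1 -> 0 < z2 -> inA w1 w2 -> 0 < w1 -> 0 < w2 ->
  inA (tau1 * z1 - tau1 * w1) (tau2 * z2 - tau2 * w2) ->
  exists k i, P (2 * k) <= z1 /\ P (- (2 * k)) <= z2 /\
    P (2 * (k + 2 * i)) <= w1 /\ P (- (2 * (k + 2 * i))) <= w2.
Proof.
  intros Hz Hz1 Hz2 Hw Hw1 Hw2 HT.
  destruct (inA_pos_two_units z1 z2 Hz Hz1 Hz2) as (k&K1&K2&K).
  destruct (inA_pos_two_units w1 w2 Hw Hw1 Hw2) as (l&L1&L2&L).
  destruct (even_cases (l - k)) as (i&[Hi|Hi]).
  { exists k, i; replace (k + 2 * i)%Z with l by lia; auto. }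
  destruct K as [[K3 K4]|(s&Hs&S1&S2)].
  { exists (k + 1)%Z, i; replace (k + 1 + 2 * i)%Z with l by lia; auto. }
  destruct L as [[L3 L4]|(s'&Hs'&S1'&S2')].
  { exists k, (i + 1)%Z; replace (k + 2 * (i + 1))%Z with (l + 1)%Z by lia; auto. }
  exfalso.
  assert (C := phi4_cong i); unfold cong1 in C.
  rewrite S1, S2, S1', S2' in HT.
  apply (inA_mul _ _ _ _ (inA_unit (- k))) in HT.
  replace (2 * - k)%Z with (- (2 * k))%Z in HT by lia; rewrite Z.opp_involutive in HT.
  replace l with (k + 2 * i + 1)%Z in HT by lia.
  replace (2 * (k + 2 * i + 1))%Z with (2 * k + (2 * (2 * i) + 2))%Z in HT by lia.
  replace (- (2 * k + (2 * (2 * i) + 2)))%Z with (- (2 * k) + (- (2 * (2 * i)) + -2))%Z in HT by lia.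
  rewrite !P_add, P_2, P_m2 in HT.
  assert (PN := P_mul_neg (2 * k)).
  set (c := P (2 * k)) in *; set (c' := P (- (2 * k))) in *.
  set (q := P (2 * (2 * i))) in *; set (q' := P (- (2 * (2 * i)))) in *.
  assert (H5 := sqrt5_neq_0); assert (Hsq := sqrt5_sq).
  replace (c' * (tau1 * (IZR s * c) - tau1 * (IZR s' * (c * (q * (phi + 1))))))
    with (tau1 * (IZR s - IZR s' * (q * (phi + 1)))) in HT
    by (transitivity (c * c' * (tau1 * (IZR s - IZR s' * (q * (phi + 1))))); [rewrite PN; ring|ring]).
  replace (c * (tau2 * (IZR s * c') - tau2 * (IZR s' * (c' * (q' * (2 - phi))))))
    with (tau2 * (IZR s - IZR s' * (q' * (2 - phi)))) in HT
    by (transitivity (c * c' * (tau2 * (IZR s - IZR s' * (q' * (2 - phi))))); [rewrite PN; ring|ring]).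
  (* From tau (phi^2 + 1) = 1, phi^2 acts as -1 on tau modulo A, and phi^(4i) acts as 1; so the
     difference tau (s - s' phi^(4i+2)) becomes tau (s + s'). *)
  assert (HT2 : inA (tau1 * (IZR s + IZR s')) (tau2 * (IZR s + IZR s'))).
  { replace (tau1 * (IZR s + IZR s')) with
      (tau1 * (IZR s - IZR s' * (q * (phi + 1))) + (IZR s' * phi * ((q - 1) / s5) + IZR s')).
    2:{ assert (Ht : tau1 * (phi + 2) = 1).
        { unfold tau1; apply Rmult_eq_reg_r with s5; [|assumption]; field_simplify; [|assumption].
          rewrite sqrt5_phi; ring [phi_sq]. }
        assert (Ht' : tau1 * (phi + 1) = phi / s5).
        { unfold tau1; apply Rmult_eq_reg_r with s5; [|assumption]; field_simplify; [|assumption..].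
          ring [phi_sq]. }
        transitivity (tau1 * IZR s - IZR s' * q * (tau1 * (phi + 1)) + IZR s' * q * (phi / s5)
          - IZR s' * (phi / s5) + IZR s'); [unfold Rdiv; ring|].
        rewrite <- Ht'.
        transitivity (tau1 * IZR s + IZR s' * (1 - tau1 * (phi + 1))); [ring|].
        replace (1 - tau1 * (phi + 1)) with tau1 by lra; ring. }
    replace (tau2 * (IZR s + IZR s')) with
      (tau2 * (IZR s - IZR s' * (q' * (2 - phi))) + (IZR s' * psi * (- ((q' - 1) / s5)) + IZR s')).
    2:{ assert (Ht : tau2 * (3 - phi) = 1).
        { unfold tau2; apply Rmult_eq_reg_r with s5; [|assumption]; field_simplify; [|assumption].
          rewrite sqrt5_phi; ring [phi_sq]. }
        assert (Ht' : tau2 * (2 - phi) = - psi / s5).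
        { unfold tau2; rewrite psi_phi; apply Rmult_eq_reg_r with s5; [|assumption]; field_simplify; [|assumption..].
          ring [phi_sq]. }
        transitivity (tau2 * IZR s - IZR s' * q' * (tau2 * (2 - phi)) + IZR s' * q' * (- psi / s5)
          - IZR s' * (- psi / s5) + IZR s'); [unfold Rdiv; ring|].
        rewrite <- Ht'.
        transitivity (tau2 * IZR s + IZR s' * (1 - tau2 * (2 - phi))); [ring|].
        replace (1 - tau2 * (2 - phi)) with tau2 by lra; ring. }
    auto with ina. }
  (* The norm of tau (s + s') is (s + s')^2 / 5, but s + s' is 2, 3 or 4. *)
  apply inA_norm in HT2; destruct HT2 as (z&Hz').
  assert (Hzz : ((s + s') * (s + s') = 5 * z)%Z).
  { apply eq_IZR; rewrite !mult_IZR, plus_IZR, <- Hz'.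
    transitivity (5 * (tau1 * tau2) * ((IZR s + IZR s') * (IZR s + IZR s'))); [|ring].
    rewrite tau_norm; field. }
  assert (s = 1 \/ s = 2)%Z as [-> | ->] by lia;
  assert (s' = 1 \/ s' = 2)%Z as [-> | ->] by lia; lia.
Qed.

(** If lam or mu vanishes, the other lies in A and dominates a unit. Otherwise lam = tau z and mu =
    tau w, and [parity_units] finds phi^(2k) below z and phi^(2k+4i) below w, so phi^(2k) [delta i]
    can be subtracted inside the cone. *)
Lemma indec_eta_cone (a : el) : indec p a ->
  let s11 := sigma p true true a in let s10 := sigma p true false a in
  let s01 := sigma p false true a in let s00 := sigma p false false a in
  s10 <= s11 <= eta * eta * s10 /\ s01 <= s00 <= eta * eta * s01 ->
  assoc p a el1 \/ exists i, assoc p a (delta i).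
Proof.
  intros Ha; simpl; intros Hc.
  assert (HOK := proj1 (proj1 Ha)).
  rewrite (el_as_LM a) in Ha, HOK, Hc |- *.
  set (l1 := U1 a - V1 a / s5 * IZR X) in *; set (l2 := U2 a + V2 a / s5 * IZR X) in *.
  set (m1 := V1 a / s5) in *; set (m2 := - (V2 a / s5)) in *.
  clearbody l1 l2 m1 m2; clear a.
  destruct (in_OK_LM _ _ _ _ HOK) as (Hl&Hm&Hlm).
  rewrite !sigma_LM in Hc; simpl in Hc.
  assert (EI := eta_inv); assert (EG := eta_gt); assert (EP := eta_inv_pos); assert (X4 := XR4).
  set (eti := IZR X - s5 * sp) in *.
  assert (Hlt : eti < eta) by nra.
  assert (Hnn : forall c b, c + b * eti <= c + b * eta <= eta * eta * (c + b * eti) -> 0 <= c /\ 0 <= b).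
  { intros c b [B1 B2]; split.
    - replace (eta * eta * (c + b * eti)) with (eta * eta * c + eta * b * (eta * eti)) in B2 by ring.
      rewrite EI in B2.
      assert (1 < eta * eta) by nra.
      apply Rmult_le_reg_l with (eta * eta - 1); lra.
    - apply Rmult_le_reg_r with (eta - eti); lra. }
  destruct Hc as [Hc1 Hc2].
  destruct (Hnn _ _ Hc1) as [N1 N2], (Hnn _ _ Hc2) as [N3 N4].
  assert (Zl := inA_sqrt5_zero_iff _ _ Hl); assert (Zm := inA_sqrt5_zero_iff _ _ Hm).
  destruct (Req_dec m1 0) as [M1|M1].
  { left; assert (M2 : m2 = 0) by tauto; subst m1 m2.
    rewrite !Rminus_0_r in Hlm.
    destruct (inA_nonneg_cases _ _ Hlm N1 N3) as [[Z1 Z2]|[Q1 Q2]].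
    - exfalso; assert (T := proj2 (proj1 Ha) true true); rewrite sigma_LM in T; simpl in T; lra.
    - destruct (inA_pos_unit _ _ Hlm Q1 Q2) as (k&K1&K2).
      exists (el_phi k); split; [apply tp_unit_phi|].
      replace (elmul p (el_phi k) el1) with (LM (P (2 * k)) (P (- (2 * k))) 0 0)
        by (transitivity (el_phi k); [unfold LM, el_phi; f_equal; ring|ring]).
      assert (Ek : LM (P (2 * k)) (P (- (2 * k))) 0 0 = el_phi k)
        by (unfold LM, el_phi; f_equal; ring).
      assert (Hk := proj2 (tp_unit_phi k)); rewrite <- Ek in Hk.
      apply (indec_eq_of_sub p); [assumption|assumption|].
      assert (HS := in_OK_sub p p_sqfree r_sqfree p_mod4 _ _ HOK (proj1 Hk)).
      rewrite LM_sub in *; apply LM_cone; try assumption; lra. }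
  destruct (Req_dec l1 0) as [L1|L1].
  { left; assert (L2 : l2 = 0) by tauto; subst l1 l2.
    apply inA_opp in Hlm; replace (- (0 - m1)) with m1 in Hlm by ring;
      replace (- (0 - m2)) with m2 in Hlm by ring.
    assert (Q1 : 0 < m1) by lra.
    assert (Q2 : 0 < m2) by (destruct N4 as [|N4]; [assumption|symmetry in N4; tauto]).
    destruct (inA_pos_unit _ _ Hlm Q1 Q2) as (k&K1&K2).
    assert (HU : tp_unit p (elmul p (el_phi k) el_eta))
      by (apply tp_unit_mul; auto using p_pos, tp_unit_phi, tp_unit_eta).
    exists (elmul p (el_phi k) el_eta); split; [assumption|].
    assert (Ek : LM 0 0 (P (2 * k)) (P (- (2 * k))) = elmul p (el_phi k) el_eta)
      by (unfold LM, el_phi, el_eta; rewrite mk_mul; f_equal; ring).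
    replace (elmul p (elmul p (el_phi k) el_eta) el1) with (elmul p (el_phi k) el_eta) by ring.
    rewrite <- Ek in HU |- *.
    apply (indec_eq_of_sub p); [assumption|apply HU|].
    assert (HS := in_OK_sub p p_sqfree r_sqfree p_mod4 _ _ HOK (proj1 (proj2 HU))).
    rewrite LM_sub in *; apply LM_cone; try assumption; lra. }
  right.
  assert (Q1 : 0 < l1) by lra. assert (Q3 : 0 < m1) by lra.
  assert (Q2 : 0 < l2) by (destruct N3 as [|N3]; [assumption|symmetry in N3; tauto]).
  assert (Q4 : 0 < m2) by (destruct N4 as [|N4]; [assumption|symmetry in N4; tauto]).
  assert (T1 := tau1_pos); assert (T2 := tau2_pos).
  assert (H5 := sqrt5_neq_0); assert (B5 := sqrt5_bounds); assert (PB := phi_bounds).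
  (* Division by tau is multiplication by phi sqrt 5, which carries A/sqrt 5 into A. *)
  assert (TT1 : forall z, z = tau1 * (phi * (s5 * z))).
  { intros z; unfold tau1; apply Rmult_eq_reg_r with s5; [|assumption]; field_simplify; [|assumption..].
    ring [phi_sq]. }
  assert (TT2 : forall z, z = tau2 * (psi * (- s5 * z))).
  { intros z; unfold tau2; rewrite psi_phi; apply Rmult_eq_reg_r with s5; [|assumption];
    field_simplify; [|assumption..]; ring [phi_sq]. }
  assert (Hlz : inA (phi * (s5 * l1)) (psi * (- s5 * l2))) by auto with ina.
  assert (Hmz : inA (phi * (s5 * m1)) (psi * (- s5 * m2))) by auto with ina.
  rewrite (TT1 l1), (TT2 l2), (TT1 m1), (TT2 m2) in Hlm.
  assert (Pos : forall t z z', 0 < t -> 0 < z -> z = t * z' -> 0 < z').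
  { intros t z z' Ht Hz E; apply Rmult_lt_reg_l with t; lra. }
  destruct (parity_units _ _ _ _ Hlz (Pos _ _ _ T1 Q1 (TT1 l1)) (Pos _ _ _ T2 Q2 (TT2 l2))
     Hmz (Pos _ _ _ T1 Q3 (TT1 m1)) (Pos _ _ _ T2 Q4 (TT2 m2)) Hlm) as (k&i&K1&K2&K3&K4).
  exists i, (el_phi k); split; [apply tp_unit_phi|].
  assert (HT : totpos p (elmul p (el_phi k) (delta i)))
    by (apply totpos_mul; auto using p_pos, totpos_delta; apply tp_unit_phi).
  unfold delta in *; rewrite LM_phi in *.
  apply (indec_eq_of_sub p); [assumption|assumption|].
  assert (HS := in_OK_sub p p_sqfree r_sqfree p_mod4 _ _ HOK (proj1 HT)).
  rewrite LM_sub in *.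
  assert (Sub : forall t z z' w, 0 < t -> z = t * z' -> w <= z' -> 0 <= z - w * t).
  { intros t z z' w Ht -> Hw; assert (w * t <= z' * t) by (apply Rmult_le_compat_r; lra); lra. }
  apply LM_cone; try assumption.
  - apply (Sub _ _ _ _ T1 (TT1 l1) K1).
  - apply (Sub _ _ _ _ T2 (TT2 l2) K2).
  - replace (P (2 * k) * (tau1 * P (2 * (2 * i)))) with (P (2 * (k + 2 * i)) * tau1)
      by (replace (2 * (k + 2 * i))%Z with (2 * k + 2 * (2 * i))%Z by lia; rewrite P_add; ring).
    apply (Sub _ _ _ _ T1 (TT1 m1) K3).
  - replace (P (- (2 * k)) * (tau2 * P (- (2 * (2 * i))))) with (P (- (2 * (k + 2 * i))) * tau2)
      by (replace (- (2 * (k + 2 * i)))%Z with (- (2 * k) + - (2 * (2 * i)))%Z by lia; rewrite P_add; ring).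
    apply (Sub _ _ _ _ T2 (TT2 m2) K4).
Qed.

Lemma indec_cases (a : el) : indec p a -> assoc p a el1 \/ exists i, assoc p a (delta i).
Proof.
  intros Ha; destruct (unit_reduction a (proj1 Ha)) as (b&Hab&_&Hc).
  assert (Hb : indec p b)
    by (apply indec_assoc with a; auto using p_pos; apply assoc_sym; auto using p_pos).
  destruct Hc as [Hc|Hc].
  - left; apply assoc_trans with b; auto using p_pos; now apply indec_eps_cone.
  - destruct (indec_eta_cone b Hb Hc) as [H|(i&H)]; [left|right; exists i];
      apply assoc_trans with b; auto using p_pos.
Qed.

(** Conjugation sends [eta] to 1/eta, and phi^(-4i) eta tau (1 + phi^(4i) / eta) = tau (1 +
    phi^(-4i) eta). *)
Lemma delta_neg_assoc (i : Z) : assoc p (delta (- i)) (elconj true false (delta i)).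
Proof.
  exists (elmul p (el_phi (- (2 * i))) el_eta); split.
  { apply tp_unit_mul; auto using p_pos, tp_unit_phi, tp_unit_eta. }
  unfold el_phi, el_eta, delta, LM; rewrite mk_conj, !mk_mul.
  replace (2 * (2 * - i))%Z with (- (2 * (2 * i)))%Z by lia.
  replace (2 * - (2 * i))%Z with (- (2 * (2 * i)))%Z by lia.
  rewrite !Z.opp_involutive.
  assert (PN := P_mul_neg (2 * (2 * i))).
  set (q := P (2 * (2 * i))) in *; set (q' := P (- (2 * (2 * i)))) in *.
  assert (HX := XX_p); assert (H5 := sqrt5_sq).
  assert (PN' : q' * q = 1) by lra.
  f_equal; ring [PN PN' HX H5].
Qed.

Lemma indec_delta_neg (i : Z) : indec p (delta i) -> indec p (delta (- i)).
Proof.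
  intros H; apply indec_assoc with (elconj true false (delta i)); auto using p_pos, delta_neg_assoc.
  apply indec_conj; auto using p_pos.
Qed.

(** * Indecomposability of [delta i] for small i *)

Lemma P_neg_m_lt_1 : P (- m) < 1.
Proof. change 1 with (P 0); apply P_lt; lia. Qed.

Lemma X_lt_P : IZR X < P m.
Proof. rewrite X_phi; assert (H := P_pos (- m)); lra. Qed.

Lemma X_gt_P : P (m - 1) < IZR X.
Proof.
  rewrite X_phi; assert (H := P_neg_m_lt_1); assert (B := phi_bounds).
  replace (P m) with (P (m - 1) * phi)
    by (replace m with (m - 1 + 1)%Z at 2 by lia; rewrite P_add; simpl; ring).
  assert (H2 : P 2 <= P (m - 1)) by (apply P_le; lia); rewrite P_2 in H2.
  assert ((phi + 1) * (phi - 1) <= P (m - 1) * (phi - 1)) by (apply Rmult_le_compat_r; lra).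
  assert ((phi + 1) * (phi - 1) = phi) by (ring [phi_sq]).
  lra.
Qed.

Section Functional.
Variable i : Z.
Hypothesis Hi : (0 <= i <= 3 * Z.of_nat n + 1)%Z.
Notation c := (P (2 * (1 - 2 * i))).
Notation c' := (P (- (2 * (1 - 2 * i)))).

(* The trace of [a] times a totally positive element of the codifferent. *)
Definition trace_form (a : el) : R :=
  tau2 * (U1 a - V1 a / s5 * IZR X + c * (V1 a / s5)) +
  tau1 * (U2 a + V2 a / s5 * IZR X - c' * (V2 a / s5)).

(** The form is the trace to Q of phi (U + w V)/sqrt 5 with w = (phi^(2-4i) - X)/sqrt 5. Both
    phi^(2-4i) and X are -1 modulo sqrt 5, so w lies in A, and elements of A/sqrt 5 have integral
    trace by [inA_diff]. *)
Lemma trace_form_isZ (a : el) : in_OK p a -> isZ (trace_form a).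
Proof.
  intros [HU HV]%iOK.
  destruct HX5 as (k&Hk).
  assert (Hk' : IZR X + 1 = 5 * IZR k) by (apply (f_equal IZR) in Hk; rewrite plus_IZR, mult_IZR in Hk; lra).
  assert (H5 := sqrt5_neq_0); assert (Hsq := sqrt5_sq).
  assert (C := phi4_cong (- i)); unfold cong1 in C.
  set (w1 := (c - IZR X) / s5); set (w2 := - ((c' - IZR X) / s5)).
  assert (Hw : inA w1 w2).
  { unfold w1, w2.
    replace (2 * (1 - 2 * i))%Z with (2 * (2 * - i) + 2)%Z by lia.
    replace (- (2 * (2 * - i) + 2))%Z with (- (2 * (2 * - i)) + -2)%Z by lia.
    rewrite !P_add, P_2, P_m2.
    set (q := P (2 * (2 * - i))) in *; set (q' := P (- (2 * (2 * - i)))) in *.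
    replace ((q * (phi + 1) - IZR X) / s5) with ((phi + 1) * ((q - 1) / s5) + (phi - IZR k * s5)).
    2:{ apply Rmult_eq_reg_r with s5; [|assumption].
        transitivity ((phi + 1) * (q - 1) + s5 * phi - 5 * IZR k).
        - replace (q - 1) with (s5 * ((q - 1) / s5)) at 2 by (field; assumption); ring [Hsq].
        - rewrite <- Hk', sqrt5_phi at 1; transitivity (q * (phi + 1) - IZR X); [ring [phi_sq]|field; assumption]. }
    replace (- ((q' * (2 - phi) - IZR X) / s5)) with
      ((1 + psi) * (- ((q' - 1) / s5)) + (psi - IZR k * - s5)).
    2:{ rewrite psi_phi; apply Rmult_eq_reg_r with s5; [|assumption].
        transitivity (- (2 - phi) * (q' - 1) + s5 * (1 - phi) + 5 * IZR k).
        - replace (q' - 1) with (s5 * ((q' - 1) / s5)) at 2 by (field; assumption); ring [Hsq].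
        - rewrite <- Hk', sqrt5_phi at 1; transitivity (- (q' * (2 - phi) - IZR X)); [ring [phi_sq]|field; assumption]. }
    replace (phi + 1) with (1 + phi) by ring.
    auto with ina. }
  assert (Hz : inA (phi * (U1 a + w1 * V1 a)) (psi * (U2 a + w2 * V2 a))) by auto with ina.
  apply inA_diff in Hz.
  replace (trace_form a) with ((phi * (U1 a + w1 * V1 a) - psi * (U2 a + w2 * V2 a)) / s5); [assumption|].
  unfold trace_form, w1, w2, tau1, tau2; rewrite psi_phi; field; assumption.
Qed.

(** At each place the form evaluates l + x u at a point x strictly between 1/eta and eta. Total
    positivity makes this affine function positive at both end points. *)
Lemma trace_form_pos (a : el) : totpos p a -> 0 < trace_form a.
Proof.
  intros Ha.
  assert (EI := eta_inv); assert (EG := eta_gt); assert (EP := eta_inv_pos); assert (X4 := XR4).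
  set (eti := IZR X - s5 * sp) in *.
  assert (Hc0 := P_pos (2 * (1 - 2 * i))); assert (Hc0' := P_pos (- (2 * (1 - 2 * i)))).
  assert (PN := P_mul_neg (2 * (1 - 2 * i))).
  (* The range of i enters here: 0 <= i gives c <= phi^2, and i <= 3n+1 gives 4i - 2 <= m - 1, so c'
     <= phi^(m-1) < X. *)
  assert (Hc : c < eta).
  { assert (H : c <= P 2) by (apply P_le; lia); rewrite P_2 in H; assert (B := phi_bounds); lra. }
  assert (Hc' : c' < eta).
  { assert (H : c' <= P (m - 1)) by (apply P_le; lia); assert (B := X_gt_P); lra. }
  assert (Hlow : forall x y, 0 < x -> x * y = 1 -> y < eta -> eti < x).
  { intros x y Hx Hxy Hy.
    assert (x * y < x * eta) by (apply Rmult_lt_compat_l; lra).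
    apply Rmult_lt_reg_l with eta; lra. }
  assert (HL := Hlow c c' Hc0 PN Hc'); assert (HL' := Hlow c' c Hc0' ltac:(lra) Hc).
  assert (Hpos : forall l u x, 0 < l + u * eta -> 0 < l + u * eti -> eti < x -> x < eta -> 0 < l + x * u).
  { intros l u x A1 A2 B1 B2.
    assert (D : 0 < eta - eti) by lra.
    apply Rmult_lt_reg_r with (eta - eti); [assumption|].
    replace ((l + x * u) * (eta - eti)) with
      ((x - eti) * (l + u * eta) + (eta - x) * (l + u * eti)) by ring.
    rewrite Rmult_0_l; apply Rplus_lt_0_compat; apply Rmult_lt_0_compat; lra. }
  rewrite (el_as_LM a) in Ha; destruct Ha as [_ Ha].
  assert (S1 := Ha true true); assert (S2 := Ha true false);
  assert (S3 := Ha false true); assert (S4 := Ha false false).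
  rewrite sigma_LM in S1, S2, S3, S4; simpl in S1, S2, S3, S4.
  unfold trace_form; apply Rplus_lt_0_compat; apply Rmult_lt_0_compat; auto using tau1_pos, tau2_pos.
  replace (_ - _) with (U2 a + V2 a / s5 * IZR X + c' * (- (V2 a / s5))) by ring.
  now apply Hpos.
Qed.

Lemma trace_form_add (a b : el) : trace_form (eladd a b) = trace_form a + trace_form b.
Proof. unfold trace_form, U1, U2, V1, V2; simpl; field; apply sqrt5_neq_0. Qed.

(** The exponent in c cancels phi^(4i), leaving tau1 tau2 (2 + phi^2 + phi^(-2)) = 5/5. *)
Lemma trace_form_delta : trace_form (delta i) = 1.
Proof.
  unfold trace_form, delta, LM; rewrite U1_mk, U2_mk, V1_mk, V2_mk.
  replace (2 * (1 - 2 * i))%Z with (- (2 * (2 * i)) + 2)%Z by lia.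
  replace (- (- (2 * (2 * i)) + 2))%Z with (2 * (2 * i) + -2)%Z by lia.
  rewrite !P_add, P_2, P_m2.
  assert (PN := P_mul_neg (2 * (2 * i))).
  set (q := P (2 * (2 * i))) in *; set (q' := P (- (2 * (2 * i)))) in *.
  assert (PN' : q' * q = 1) by lra.
  transitivity (tau1 * tau2 * (2 + q * q' * (phi + 1) + q * q' * (2 - phi)));
    [field; apply sqrt5_neq_0|].
  rewrite PN, tau_norm; field.
Qed.

Lemma indec_delta_nonneg : indec p (delta i).
Proof.
  split; [apply totpos_delta|]; intros (b&d&Hb&Hd&E).
  assert (F : forall a, totpos p a -> 1 <= trace_form a).
  { intros a Ha; destruct (trace_form_isZ a (proj1 Ha)) as (z&Hz).
    assert (H := trace_form_pos a Ha); rewrite Hz in *; apply IZR_le; apply lt_IZR in H; lia. }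
  assert (H := trace_form_delta); rewrite E, trace_form_add in H.
  assert (H1 := F b Hb); assert (H2 := F d Hd); lra.
Qed.
End Functional.

Lemma indec_delta (i : Z) : (Z.abs i <= 3 * Z.of_nat n + 1)%Z -> indec p (delta i).
Proof.
  intros Hi; destruct (Z_le_gt_dec 0 i) as [H|H].
  - apply indec_delta_nonneg; lia.
  - rewrite <- (Z.opp_involutive i); apply indec_delta_neg, indec_delta_nonneg; lia.
Qed.

(** * Identities in phi^m and the remaining [delta i] *)

Lemma sqrt5_inv : / s5 = s5 / 5.
Proof.
  assert (H := sqrt5_neq_0); apply Rmult_eq_reg_l with s5; [|assumption].
  rewrite Rinv_r by assumption; transitivity (s5 * s5 / 5); [rewrite sqrt5_sq; field|field].
Qed.

(** With a = phi^m and b = 1/a, the identities below become polynomial in phi, a, b, and [ring]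
    checks them from phi^2 = phi + 1 and ab = 1. *)
Lemma XYp_P : exists a b, P m = a /\ P (- m) = b /\ a * b = 1 /\
  IZR X = a - b /\ IZR Y = (a + b) / s5 /\ IZR p = (a + b) * (a + b) / 5 - 1.
Proof.
  exists (P m), (P (- m)).
  assert (HY : IZR Y = (P m + P (- m)) / s5)
    by (rewrite <- Y_phi; field; apply sqrt5_neq_0).
  split; [reflexivity|]; split; [reflexivity|]; split; [apply P_mul_neg|].
  split; [apply X_phi|]; split; [assumption|].
  assert (H := YY_p); rewrite HY in H; assert (Hs := sqrt5_sq).
  replace (((P m + P (- m)) / s5 * ((P m + P (- m)) / s5))) with
    ((P m + P (- m)) * (P m + P (- m)) / (s5 * s5)) in H by (field; apply sqrt5_neq_0).
  rewrite Hs in H; lra.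
Qed.

Lemma P_1 : P 1 = phi. Proof. simpl; ring. Qed.
Lemma P_m1 : P (-1) = phi - 1. Proof. rewrite <- phi_inv; simpl; f_equal; ring. Qed.
Lemma P_5 : P 5 = 5 * phi + 3.
Proof. change (P 5) with (P (2 + 2 + 1)); rewrite !P_add, P_2, P_1; ring [phi_sq]. Qed.
Lemma P_m5 : P (-5) = 5 * phi - 8.
Proof. change (P (-5)) with (P (-2 + -2 + -1)); rewrite !P_add, P_m2, P_m1; ring [phi_sq]. Qed.

Lemma delta_sum_of_units :
  delta (3 * Z.of_nat n + 2) =
  eladd (elmul p (el_phi (6 * Z.of_nat n + 2)) el_eps)
        (elmul p (el_phi 1) (elmul p el_eps el_eta)).
Proof.
  unfold delta, LM, el_phi, el_eps, el_eta; rewrite !mk_mul, mk_add.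
  replace (2 * (2 * (3 * Z.of_nat n + 2)))%Z with (m + 5)%Z by lia.
  replace (2 * (6 * Z.of_nat n + 2))%Z with (m + 1)%Z by lia.
  replace (- (m + 5))%Z with (- m + -5)%Z by lia.
  replace (- (m + 1))%Z with (- m + -1)%Z by lia.
  change (2 * 1)%Z with 2%Z; change (- (2))%Z with (-2)%Z.
  rewrite (P_add m 5), (P_add m 1), (P_add (- m) (-5)), (P_add (- m) (-1)).
  rewrite P_2, P_m2, P_1, P_m1, P_5, P_m5.
  destruct XYp_P as (a&b&Ea&Eb&Hab&EX&EY&Ep); rewrite Ea, Eb, EX, EY, Ep.
  unfold tau1, tau2, Rdiv; rewrite sqrt5_inv, sqrt5_phi.
  f_equal; field_simplify_eq; ring [phi_sq Hab].
Qed.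

Lemma delta_decomposes (i : Z) : (3 * Z.of_nat n + 2 <= i)%Z -> ~ indec p (delta i).
Proof.
  intros Hi [_ H]; apply H; clear H.
  destruct (Z.eq_dec i (3 * Z.of_nat n + 2)) as [->|Hne].
  { eexists; eexists; split; [|split]; [| |apply delta_sum_of_units];
      repeat apply totpos_mul; auto using p_pos;
      first [apply tp_unit_phi|apply tp_unit_eps|apply tp_unit_eta]. }
  exists (el_phi 1), (elsub (delta i) (el_phi 1)); split; [apply tp_unit_phi|].
  split; [|ring].
  split; [apply in_OK_sub; auto using in_OK_delta; apply (tp_unit_phi 1)|].
  assert (Ek : LM (P (2 * 1)) (P (- (2 * 1))) 0 0 = el_phi 1) by (unfold LM, el_phi; f_equal; ring).
  intros s1 s2; unfold delta; rewrite <- Ek, LM_sub, sigma_LM, !Rminus_0_r.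
  change (2 * 1)%Z with 2%Z; change (- (2))%Z with (-2)%Z; rewrite P_2, P_m2.
  assert (EI := eta_inv); assert (EG := eta_gt); assert (EL := eta_lt); assert (EP := eta_inv_pos).
  assert (X4 := XR4); assert (B := phi_bounds); assert (S := sqrt5_bounds).
  set (eti := IZR X - s5 * sp) in *.
  assert (HP8 : P 8 = 21 * phi + 13).
  { change (P 8) with (P (2 + 2 + 2 + 2)); rewrite !P_add, P_2; ring [phi_sq]. }
  (* Now 4i >= m + 9 and phi^8 > 46. With eta < 2X < 2 phi^m this gives phi^(4i) / eta > 23, so the
     first place exceeds 24 tau1 > phi^2; at the second place tau2 > phi^(-2) already. *)
  assert (Hq : 46 * P m < P (2 * (2 * i))).
  { apply Rlt_le_trans with (P (m + 8)); [|apply P_le; lia].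
    rewrite (P_add m 8), HP8; assert (Q := P_pos m).
    rewrite Rmult_comm; apply Rmult_lt_compat_l; lra. }
  assert (HT1 : 0.276 < tau1).
  { unfold tau1; apply Rmult_lt_reg_r with s5; [lra|]; unfold Rdiv.
    rewrite Rmult_assoc, Rinv_l by lra; lra. }
  assert (HT2 : 0.7 < tau2).
  { unfold tau2; apply Rmult_lt_reg_r with s5; [lra|]; unfold Rdiv.
    rewrite Rmult_assoc, Rinv_l by lra; lra. }
  assert (Qp := P_pos (- (2 * (2 * i)))).
  set (q := P (2 * (2 * i))) in *; set (q' := P (- (2 * (2 * i)))) in *.
  assert (XP := X_lt_P).
  assert (Hqe : 23 < q * eti).
  { assert (46 * IZR X < q) by lra.
    assert (23 * eta < q) by lra.
    replace 23 with (23 * eta * eti) by (rewrite Rmult_assoc, EI; ring).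
    apply Rmult_lt_compat_r; lra. }
  assert (Hqe' : 23 < q * eta) by (assert (eti < eta) by nra; assert (0 < q) by lra; nra).
  assert (W : 0 < (if Bool.eqb s1 s2 then eta else eti)) by (destruct (Bool.eqb s1 s2); lra).
  destruct s1; cbv iota.
  - assert (23 < q * (if Bool.eqb true s2 then eta else eti)) by (destruct s2; assumption).
    rewrite Rmult_assoc; nra.
  - assert (0 < tau2 * q' * (if Bool.eqb false s2 then eta else eti))
      by (apply Rmult_lt_0_compat; [apply Rmult_lt_0_compat; lra|assumption]).
    lra.
Qed.

Lemma indec_delta_range (i : Z) : indec p (delta i) -> (Z.abs i <= 3 * Z.of_nat n + 1)%Z.
Proof.
  intros H.
  destruct (Z_le_gt_dec (Z.abs i) (3 * Z.of_nat n + 1)) as [|Hi]; [assumption|exfalso].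
  destruct (Z_le_gt_dec 0 i).
  - apply (delta_decomposes i); [lia|assumption].
  - apply (delta_decomposes (- i)); [lia|now apply indec_delta_neg].
Qed.

(** The only coincidence among the indecomposable [delta i]; it makes 6n+2 classes out of 6n+3
    indices. *)
Lemma delta_ends_assoc :
  assoc p (delta (3 * Z.of_nat n + 1)) (delta (- (3 * Z.of_nat n + 1))).
Proof.
  exists (elmul p (el_phi (6 * Z.of_nat n + 2)) el_eps); split.
  { apply tp_unit_mul; auto using p_pos, tp_unit_phi, tp_unit_eps. }
  unfold delta, LM, el_phi, el_eps; rewrite !mk_mul.
  replace (2 * (2 * - (3 * Z.of_nat n + 1)))%Z with (- (m + 1))%Z by lia.
  replace (2 * (2 * (3 * Z.of_nat n + 1)))%Z with (m + 1)%Z by lia.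
  replace (2 * (6 * Z.of_nat n + 2))%Z with (m + 1)%Z by lia.
  rewrite Z.opp_involutive.
  replace (- (m + 1))%Z with (- m + -1)%Z by lia.
  rewrite (P_add m 1), (P_add (- m) (-1)), P_1, P_m1.
  destruct XYp_P as (a&b&Ea&Eb&Hab&EX&EY&Ep); rewrite Ea, Eb, EX, EY, Ep.
  unfold tau1, tau2, Rdiv; rewrite sqrt5_inv, sqrt5_phi.
  f_equal; field_simplify_eq; ring [phi_sq Hab].
Qed.

Lemma rho_delta :
  El ((IZR X + IZR Y) / 2) 0 (- 1 / 2) (1 / 2) =
  elmul p (el_phi (6 * Z.of_nat n + 2)) (delta (- (3 * Z.of_nat n + 1))).
Proof.
  unfold delta, LM, el_phi; rewrite !mk_mul.
  replace (2 * (2 * - (3 * Z.of_nat n + 1)))%Z with (- (m + 1))%Z by lia.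
  replace (2 * (6 * Z.of_nat n + 2))%Z with (m + 1)%Z by lia.
  rewrite Z.opp_involutive.
  replace (- (m + 1))%Z with (- m + -1)%Z by lia.
  rewrite (P_add m 1), (P_add (- m) (-1)), P_1, P_m1.
  destruct XYp_P as (a&b&Ea&Eb&Hab&EX&EY&Ep); rewrite Ea, Eb, EX, EY, Ep.
  rewrite (mk_eta (El _ _ _ _)); unfold U1, U2, V1, V2; simpl.
  unfold tau1, tau2, Rdiv; rewrite sqrt5_inv, sqrt5_phi.
  f_equal; field_simplify_eq; ring [phi_sq Hab].
Qed.

(** * The elements gamma_j in terms of [delta] *)

Section Gamma.
Variables (j : Z) (xj yj : R).
Hypothesis Hxy : xj + yj * s5 = 2 * P (2 * j - 1).
Hypothesis Hxy' : xj - yj * s5 = - 2 * P (- (2 * j - 1)).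

Lemma P_xy : P (2 * j) = (xj + yj * s5) * phi / 2 /\
  P (- (2 * j)) = - (xj - yj * s5) * (phi - 1) / 2.
Proof.
  rewrite Hxy, Hxy'.
  replace (2 * j)%Z with (2 * j - 1 + 1)%Z at 1 by lia.
  replace (- (2 * j))%Z with (- (2 * j - 1) + -1)%Z by lia.
  rewrite !P_add, P_1, P_m1; split; field.
Qed.

(** The factors [1 *] are kept so that the left side is gamma_j with (-1)^j replaced by its
    value. *)
Lemma gamma_even (i : Z) : j = (2 * i)%Z ->
  El ((yj * IZR X + 1) / 2) ((xj * IZR X - 1) / 10) (1 * xj / 2) (1 * yj / 2) = delta i.
Proof.
  intros Hj; destruct P_xy as [E1 E2].
  unfold delta, LM; rewrite <- Hj, E1, E2.
  rewrite (mk_eta (El _ _ _ _)); unfold U1, U2, V1, V2; simpl.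
  unfold tau1, tau2, Rdiv; rewrite sqrt5_inv, sqrt5_phi.
  f_equal; field_simplify_eq; ring [phi_sq].
Qed.

Lemma gamma_odd (i : Z) : j = (2 * i + 1)%Z ->
  El ((yj * IZR X + 1) / 2) ((xj * IZR X - -1) / 10) (-1 * xj / 2) (-1 * yj / 2) =
  elmul p (el_phi 1) (elconj true false (delta i)).
Proof.
  intros Hj; destruct P_xy as [E1 E2].
  unfold delta, LM, el_phi; rewrite mk_conj, mk_mul.
  replace (2 * (2 * i))%Z with (2 * j + -2)%Z by lia.
  replace (- (2 * j + -2))%Z with (- (2 * j) + 2)%Z by lia.
  change (2 * 1)%Z with 2%Z; change (- (2))%Z with (-2)%Z.
  rewrite (P_add (2 * j) (-2)), (P_add (- (2 * j)) 2), E1, E2, P_2, P_m2.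
  rewrite (mk_eta (El _ _ _ _)); unfold U1, U2, V1, V2; simpl.
  unfold tau1, tau2, Rdiv; rewrite sqrt5_inv, sqrt5_phi.
  f_equal; field_simplify_eq; ring [phi_sq].
Qed.
End Gamma.

(** * Classes of the [delta i] modulo units *)

Lemma elnorm_delta (i : Z) :
  elnorm p (delta i) = (P (2 * (2 * i)) + P (- (2 * (2 * i))) + 2 * IZR X) ^ 2 / 25.
Proof.
  unfold elnorm, delta; rewrite !sigma_LM; cbv [Bool.eqb].
  assert (EI := eta_inv); assert (ES : eta + (IZR X - s5 * sp) = 2 * IZR X) by (unfold eta; ring).
  set (eti := IZR X - s5 * sp) in *.
  assert (PN := P_mul_neg (2 * (2 * i))).
  set (q := P (2 * (2 * i))) in *; set (q' := P (- (2 * (2 * i)))) in *.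
  transitivity ((tau1 * tau2) ^ 2 * (((1 + q * q * (eta * eti) + q * (eta + eti)) *
     (1 + q' * q' * (eta * eti) + q' * (eta + eti))))); [ring|].
  rewrite EI, ES, tau_norm.
  transitivity ((1 + (q * q') * (q * q') + q * q + q' * q' + 4 * IZR X * IZR X * (q * q')
     + 2 * IZR X * (q + q') * (1 + q * q')) / 25); [field|].
  rewrite PN. transitivity ((q * q + q' * q' + 2 * (q * q') + 4 * IZR X * (q + q')
    + 4 * IZR X * IZR X) / 25); [rewrite PN; field|field].
Qed.

Lemma one_not_assoc_delta (i : Z) : ~ assoc p el1 (delta i).
Proof.
  intros H; apply elnorm_assoc in H; auto using p_pos.
  rewrite elnorm_delta in H; unfold elnorm in H; rewrite !sigma_one in H.
  assert (Q := P_pos (2 * (2 * i))); assert (Q' := P_pos (- (2 * (2 * i)))).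
  (* The norm exceeds (2X)^2 / 25, and 2X >= 8. *)
  assert (X4 := XR4); nra.
Qed.

Lemma P_inj (i j : Z) : P i = P j -> i = j.
Proof.
  intros H; destruct (Z.lt_trichotomy i j) as [L|[L|L]]; [|assumption|];
    apply P_lt in L; lra.
Qed.

Lemma delta_assoc_abs (i j : Z) : assoc p (delta i) (delta j) -> i = j \/ i = (- j)%Z.
Proof.
  intros H; apply elnorm_assoc in H; auto using p_pos.
  rewrite !elnorm_delta in H.
  assert (Qi := P_pos (2 * (2 * i))); assert (Qi' := P_pos (- (2 * (2 * i)))).
  assert (Qj := P_pos (2 * (2 * j))); assert (Qj' := P_pos (- (2 * (2 * j)))).
  assert (Ni := P_mul_neg (2 * (2 * i))); assert (Nj := P_mul_neg (2 * (2 * j))).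
  assert (X4 := XR4).
  assert (E : P (2 * (2 * i)) + P (- (2 * (2 * i))) = P (2 * (2 * j)) + P (- (2 * (2 * j)))).
  { assert (S : forall s t, 0 < s -> 0 < t -> s ^ 2 / 25 = t ^ 2 / 25 -> s = t).
    { intros s t Hs Ht E.
      assert (Z0 : (s - t) * (s + t) = 0) by (simpl in E; nra).
      apply Rmult_integral in Z0; destruct Z0; lra. }
    apply S in H; lra. }
  assert (F : (P (2 * (2 * i)) - P (2 * (2 * j))) * (P (2 * (2 * i)) - P (- (2 * (2 * j)))) = 0).
  { replace (P (- (2 * (2 * j)))) with (P (2 * (2 * i)) + P (- (2 * (2 * i))) - P (2 * (2 * j))) by lra.
    assert (Z1 : P (2 * (2 * j)) * (P (2 * (2 * i)) + P (- (2 * (2 * i))) - P (2 * (2 * j))) = 1)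
      by (rewrite <- Nj; f_equal; lra).
    nra. }
  apply Rmult_integral in F; destruct F as [F|F]; [left|right];
    apply Rminus_diag_uniq, P_inj in F; lia.
Qed.

(* [delta i = e * delta (- i)] forces [phi^(-4i) e = U + V sqrt p] with
   [V = sqrt 5 (q - 1/q) / (q + 1/q + 2X)] strictly between [0] and [1],
   where [q = phi^(4i)]. *)
Lemma delta_not_assoc_neg (i : Z) : (0 < i <= 3 * Z.of_nat n)%Z -> ~ assoc p (delta i) (delta (- i)).
Proof.
  intros Hi (e&He&E).
  set (f := elmul p e (el_phi (- (2 * i)))).
  assert (Hf : in_OK p f) by (apply in_OK_mul; auto; [apply He|apply tp_unit_phi]).
  assert (Ef : delta i = elmul p f (elmul p (el_phi (2 * i)) (delta (- i)))).
  { rewrite E; unfold f.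
    assert (Eu : elmul p (el_phi (- (2 * i))) (el_phi (2 * i)) = el1).
    { unfold el_phi; rewrite mk_mul, mk_one.
      replace (2 * - (2 * i))%Z with (- (2 * (2 * i)))%Z by lia; rewrite Z.opp_involutive.
      assert (PN := P_mul_neg (2 * (2 * i))); f_equal; lra. }
    transitivity (elmul p (elmul p e (elmul p (el_phi (- (2 * i))) (el_phi (2 * i)))) (delta (- i))); [|ring].
    rewrite Eu; ring. }
  apply (in_OK_iff p p_sqfree r_sqfree p_mod4) in Hf; destruct Hf as [_ HV].
  rewrite (mk_eta f) in Ef.
  unfold delta in Ef; rewrite LM_phi in Ef; unfold LM in Ef; rewrite mk_mul in Ef.
  replace (2 * (2 * - i))%Z with (- (2 * (2 * i)))%Z in Ef by lia.
  rewrite Z.opp_involutive in Ef.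
  assert (PN := P_mul_neg (2 * (2 * i))).
  assert (Q := P_pos (2 * (2 * i))); assert (Q' := P_pos (- (2 * (2 * i)))).
  (* From 4i <= m - 3 and phi^2 > 2. This makes V smaller than 1; at i = 3n+1, where 4i = m + 1, one
     has V = 1, in accordance with [delta_ends_assoc]. *)
  assert (HqX : P (2 * (2 * i)) * 2 < IZR X).
  { assert (H := X_gt_P); assert (B := phi_bounds).
    assert (P (2 * (2 * i)) <= P (m - 1 - 2)) by (apply P_le; lia).
    assert (E2 : P (m - 1) = P (m - 1 - 2) * P 2) by (rewrite <- P_add; f_equal; lia).
    rewrite P_2 in E2; assert (0 < P (m - 1 - 2)) by apply P_pos; nra. }
  assert (Hq1 : 1 < P (2 * (2 * i))) by (change 1 with (P 0); apply P_lt; lia).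
  set (q := P (2 * (2 * i))) in *; set (q' := P (- (2 * (2 * i)))) in *.
  set (u1 := U1 f) in *; set (u2 := U2 f) in *; set (v1 := V1 f) in *; set (v2 := V2 f) in *.
  assert (F1 := f_equal U1 Ef); assert (F2 := f_equal U2 Ef);
  assert (F3 := f_equal V1 Ef); assert (F4 := f_equal V2 Ef).
  rewrite !U1_mk in F1; rewrite !U2_mk in F2; rewrite !V1_mk in F3; rewrite !V2_mk in F4.
  assert (T1 := tau1_pos); assert (T2 := tau2_pos); assert (S5 := sqrt5_bounds).
  assert (Hsq := sqrt5_sq); assert (HX := XX_p).
  assert (PN' : q' * q = 1) by lra.
  assert (G1 : v1 * (q + q' + 2 * IZR X) = s5 * (q - q')).
  { assert (A1 : u1 * (q + IZR X) + IZR p * v1 * s5 = 1 + q * IZR X).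
    { apply Rmult_eq_reg_l with tau1; [|lra]. symmetry.
      transitivity (tau1 + tau1 * q * IZR X); [ring|]; rewrite F1; ring [PN PN']. }
    assert (A2 : u1 * s5 + v1 * (q + IZR X) = q * s5).
    { apply Rmult_eq_reg_l with tau1; [|lra]. symmetry.
      transitivity (tau1 * q * s5); [ring|]; rewrite F3; ring [PN PN']. }
    (* Elimination of u1; the determinant (q + X)^2 - 5p equals q^2 + 2qX + 1 because X^2 = 5p +
       1. *)
    assert (A3 : v1 * (q * q + 2 * q * IZR X + 1) = s5 * (q * q - 1)).
    { transitivity ((q + IZR X) * (u1 * s5 + v1 * (q + IZR X)) -
         s5 * (u1 * (q + IZR X) + IZR p * v1 * s5)); [ring [HX Hsq]|rewrite A1, A2; ring]. }
    apply Rmult_eq_reg_l with q; [|lra].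
    transitivity (v1 * (q * q + 2 * q * IZR X + q * q')); [ring|].
    rewrite PN, A3, <- PN; ring. }
  assert (G2 : v2 * (q + q' + 2 * IZR X) = s5 * (q - q')).
  { assert (A1 : u2 * (q' + IZR X) - IZR p * v2 * s5 = 1 + q' * IZR X).
    { apply Rmult_eq_reg_l with tau2; [|lra]. symmetry.
      transitivity (tau2 + tau2 * q' * IZR X); [ring|]; rewrite F2; ring [PN PN']. }
    assert (A2 : - u2 * s5 + v2 * (q' + IZR X) = - q' * s5).
    { apply Rmult_eq_reg_l with tau2; [|lra]. symmetry.
      transitivity (- (tau2 * q' * s5)); [ring|]; rewrite F4; ring [PN PN']. }
    assert (A3 : v2 * (q' * q' + 2 * q' * IZR X + 1) = s5 * (1 - q' * q')).
    { transitivity ((q' + IZR X) * (- u2 * s5 + v2 * (q' + IZR X)) +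
         s5 * (u2 * (q' + IZR X) - IZR p * v2 * s5)); [ring [HX Hsq]|rewrite A1, A2; ring]. }
    apply Rmult_eq_reg_l with q'; [|lra].
    transitivity (v2 * (q' * q' + 2 * q' * IZR X + q' * q)); [ring|].
    rewrite PN', A3, <- PN'; ring. }
  assert (G : v1 = v2).
  { apply Rmult_eq_reg_r with (q + q' + 2 * IZR X); [|lra]; lra. }
  destruct HV as (a&b&Ea&Eb).
  assert (Hb : IZR b = 0).
  { rewrite psi_phi in Eb; assert (B := phi_bounds).
    assert (IZR b * (2 * phi - 1) = 0) by lra.
    apply Rmult_integral in H; destruct H; lra. }
  rewrite Hb in Ea; replace (IZR a + 0 * phi) with (IZR a) in Ea by ring.
  rewrite Ea in G1.
  assert (Hq'1 : q' < 1) by nra.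
  assert (Pos : 0 < IZR a) by nra.
  assert (Lt : IZR a < 1) by nra.
  apply lt_IZR in Pos; apply lt_IZR in Lt; lia.
Qed.

Lemma delta_assoc_inj (i j : Z) :
  (- (3 * Z.of_nat n + 1) <= i <= 3 * Z.of_nat n)%Z ->
  (- (3 * Z.of_nat n + 1) <= j <= 3 * Z.of_nat n)%Z ->
  assoc p (delta i) (delta j) -> i = j.
Proof.
  intros Hi Hj H; destruct (delta_assoc_abs i j H) as [E|E]; [assumption|].
  destruct (Z.lt_trichotomy i 0) as [L|[L|L]]; [|lia|].
  - exfalso; apply (delta_not_assoc_neg j); [lia|].
    rewrite <- E; apply assoc_sym; auto using p_pos.
  - exfalso; apply (delta_not_assoc_neg i); [lia|].
    replace (- i)%Z with j by lia; assumption.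
Qed.

(** 20 p = 4 phi^(2m) + 4 phi^(-2m) - 12 lies between phi^(2m+2) and phi^(2m+6), and 2m + 6 = 4
    (6n+3). The exponents differ by 4, which is the gap of 1 after division. *)
Lemma disc_bounds :
  ln ((20 * IZR p) ^ 2) / (8 * ln phi) <= INR (6 * n + 3) <=
  ln ((20 * IZR p) ^ 2) / (8 * ln phi) + 1.
Proof.
  assert (Hp0 : 0 < IZR p) by (apply IZR_lt, p_pos).
  assert (B := phi_bounds).
  assert (HL : 0 < ln phi) by (rewrite <- ln_1; apply ln_increasing; lra).
  assert (Ha := P_pos m); assert (Hb := P_pos (- m)); assert (Hb1 := P_neg_m_lt_1).
  assert (H20 : 20 * IZR p = 4 * (P m * P m) + 4 * (P (- m) * P (- m)) - 12).
  { destruct XYp_P as (a&b&->&->&Hab&_&_&->); field_simplify_eq; ring [Hab]. }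
  assert (H3 : P 2 * phi <= P m).
  { rewrite <- P_1 at 2; rewrite <- P_add; apply P_le; lia. }
  rewrite P_2 in H3.
  assert (H4 : 4.2 < P m) by nra.
  assert (Up : 20 * IZR p <= P (m + m + 6)).
  { rewrite (P_add (m + m) 6), (P_add m m).
    assert (E6 : P 6 = 8 * phi + 5).
    { change (P 6) with (P (2 + 2 + 2)); rewrite !P_add, P_2; ring [phi_sq]. }
    rewrite E6, H20; nra. }
  assert (Low : P (m + m + 2) <= 20 * IZR p).
  { rewrite (P_add (m + m) 2), (P_add m m), P_2, H20; nra. }
  assert (LP : forall k, ln (P k) = IZR k * ln phi) by (intros; apply ln_powerRZ; lra).
  assert (Lle : forall s t, 0 < s -> s <= t -> ln s <= ln t).
  { intros s t Hs [Hst|Hst]; [left; now apply ln_increasing|right; now rewrite Hst]. }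
  apply Lle in Up; [|lra]; apply Lle in Low; [|apply P_pos].
  rewrite LP in Up, Low.
  assert (E2 : ln ((20 * IZR p) ^ 2) = 2 * ln (20 * IZR p)).
  { replace ((20 * IZR p) ^ 2) with ((20 * IZR p) * (20 * IZR p)) by ring.
    rewrite ln_mult by lra; ring. }
  rewrite E2, INR_IZR_INZ.
  replace (m + m + 6)%Z with (4 * Z.of_nat (6 * n + 3))%Z in Up by lia.
  replace (m + m + 2)%Z with (4 * Z.of_nat (6 * n + 3) - 4)%Z in Low by lia.
  rewrite minus_IZR in Low; rewrite mult_IZR in Up, Low.
  set (N := IZR (Z.of_nat (6 * n + 3))) in *; set (L := ln (20 * IZR p)) in *.
  split.
  - apply Rmult_le_reg_r with (8 * ln phi); [lra|].
    unfold Rdiv; rewrite Rmult_assoc, Rinv_l by lra; lra.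
  - apply Rplus_le_reg_r with (-1); apply Rmult_le_reg_r with (8 * ln phi); [lra|].
    replace ((2 * L / (8 * ln phi) + 1 + -1) * (8 * ln phi)) with (2 * L) by (field; lra); lra.
Qed.
End Family.

(** * The discriminant *)

Definition mat_mul (M N : nat -> nat -> R) (k j : nat) : R :=
  M k 0%nat * N 0%nat j + M k 1%nat * N 1%nat j + M k 2%nat * N 2%nat j + M k 3%nat * N 3%nat j.

Lemma det4_mul (M N : nat -> nat -> R) : det4 (mat_mul M N) = det4 M * det4 N.
Proof. unfold det4, det3, mat_mul. ring. Qed.

Lemma det4_ext (M N : nat -> nat -> R) :
  (forall k j, (k < 4)%nat -> (j < 4)%nat -> M k j = N k j) -> det4 M = det4 N.
Proof. intros H; unfold det4, det3; rewrite !H by lia; reflexivity. Qed.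

Lemma det4_isZ (A : nat -> nat -> Z) : isZ (det4 (fun i j => IZR (A i j))).
Proof.
  unfold det4, det3; repeat first [apply isZ_sub | apply isZ_add | apply isZ_mul | apply isZ_IZR].
Qed.

Lemma finite_choice (B : Type) (b0 : B) (Q : nat -> B -> Prop) (m : nat) :
  (forall i, (i < m)%nat -> exists b, Q i b) ->
  exists f, forall i, (i < m)%nat -> Q i (f i).
Proof.
  induction m as [|m IH]; intros H.
  - exists (fun _ => b0); lia.
  - destruct IH as (f&Hf); [intros; apply H; lia|].
    destruct (H m) as (b&Hb); [lia|].
    exists (fun i => if Nat.eqb i m then b else f i); intros i Hi.
    destruct (Nat.eqb_spec i m) as [->|]; [assumption|apply Hf; lia].
Qed.

Section Discriminant.
Variable p : Z.
Hypothesis p_pos : (0 < p)%Z.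
Hypothesis p_sqfree : Zsqfree p.
Hypothesis r_sqfree : Zsqfree (5 * p).
Hypothesis p_mod4 : (exists k, p = 4 * k + 3)%Z.

Definition std_basis (i : nat) : el :=
  match i with
  | 0%nat => elZ 1 0 0 0 | 1%nat => elZ 0 1 0 0 | 2%nat => elZ 0 0 1 0 | _ => elZ 0 0 0 1
  end.

Notation emb_mat w := (fun k j => sigma p (emb1 k) (emb2 k) (w j)).

Lemma zcomb_emb (z : nat -> Z) (w : nat -> el) (s1 s2 : bool) :
  sigma p s1 s2 (zcomb z w 4) =
  sigma p s1 s2 (w 0%nat) * IZR (z 0%nat) + sigma p s1 s2 (w 1%nat) * IZR (z 1%nat) +
  sigma p s1 s2 (w 2%nat) * IZR (z 2%nat) + sigma p s1 s2 (w 3%nat) * IZR (z 3%nat).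
Proof. unfold sigma; simpl; ring. Qed.

Lemma std_basis_span (a : el) : in_OK p a -> exists z, a = zcomb z std_basis 4.
Proof.
  intros Ha; destruct (in_OK_form p a) as (x&y&u&t&->); try assumption.
  exists (fun i => match i with 0%nat => x | 1%nat => y | 2%nat => u | _ => t end).
  apply El_ext; simpl; field.
Qed.

Lemma in_OK_std_basis (i : nat) : in_OK p (std_basis i).
Proof. destruct i as [|[|[|i]]]; apply in_OK_elZ. Qed.

Lemma det_std_basis : (det4 (emb_mat std_basis)) ^ 2 = (20 * IZR p) ^ 2.
Proof.
  (* The sign depends only on the order of the embeddings and disappears in the square, so both are
     allowed. *)
  assert (E : det4 (emb_mat std_basis) = 20 * IZR p \/ det4 (emb_mat std_basis) = - (20 * IZR p)).
  { assert (H5 := sqrt5_sq); assert (Hs := sp_sq p p_pos).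
    unfold det4, det3, sigma, std_basis, elZ, emb1, emb2, sg; simpl; rewrite (sqrt_5p p p_pos).
    first [left; field_simplify_eq; ring [H5 Hs] | right; field_simplify_eq; ring [H5 Hs]]. }
  destruct E as [-> | ->]; ring.
Qed.

Lemma span_matrix (v w : nat -> el) :
  (forall i, (i < 4)%nat -> exists z, v i = zcomb z w 4) ->
  exists A : nat -> nat -> Z,
    det4 (emb_mat v) = det4 (emb_mat w) * det4 (fun i j => IZR (A i j)).
Proof.
  intros H; destruct (finite_choice _ (fun _ => 0%Z) _ 4 H) as (f&Hf).
  exists (fun i j => f j i); rewrite <- det4_mul; apply det4_ext.
  intros k j _ Hj; rewrite (Hf j Hj), zcomb_emb; reflexivity.
Qed.

(** The two bases express each other through integer matrices whose determinants have product 1, so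
    the discriminant does not depend on the basis. *)
Lemma disc_value (D : R) : disc_eq p D -> D = (20 * IZR p) ^ 2.
Proof.
  intros (w&(Hw1&Hw2&_)&->); rewrite <- det_std_basis.
  destruct (span_matrix w std_basis) as (A&HA); [intros; apply std_basis_span; auto|].
  destruct (span_matrix std_basis w) as (B&HB); [intros; apply Hw2, in_OK_std_basis|].
  destruct (det4_isZ A) as (a&Ha), (det4_isZ B) as (b&Hb).
  rewrite Ha in HA; rewrite Hb in HB.
  assert (N : det4 (emb_mat std_basis) <> 0).
  { intros E; assert (S := det_std_basis); rewrite E in S.
    assert (0 < IZR p) by (now apply IZR_lt). nra. }
  assert (Hab : (a * b = 1)%Z).
  { apply eq_IZR; rewrite mult_IZR.
    apply Rmult_eq_reg_l with (det4 (emb_mat std_basis)); [|assumption].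
    rewrite Rmult_1_r; rewrite HB at 2; rewrite HA; ring. }
  assert (a = 1 \/ a = -1)%Z as [-> | ->] by (apply Z.eq_mul_1 in Hab; lia);
  rewrite HA; ring.
Qed.
End Discriminant.

(** * Uniqueness of the number of classes *)

Lemma injection_le (a b : nat) (f : nat -> nat) :
  (forall i, (i < a)%nat -> (f i < b)%nat) ->
  (forall i j, (i < a)%nat -> (j < a)%nat -> f i = f j -> i = j) -> (a <= b)%nat.
Proof.
  intros H1 H2.
  rewrite <- (List.length_seq a 0), <- (List.length_seq b 0), <- (List.length_map f (List.seq 0 a)).
  apply List.NoDup_incl_length.
  - apply List.NoDup_map_NoDup_ForallPairs; [|apply List.seq_NoDup].
    intros i j Hi Hj; apply List.in_seq in Hi, Hj; apply H2; lia.
  - intros k Hk; apply List.in_map_iff in Hk; destruct Hk as (i&<-&Hi).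
    apply List.in_seq in Hi; apply List.in_seq; specialize (H1 i); lia.
Qed.

Section Counting.
Variable p : Z.
Hypothesis p_pos : (0 < p)%Z.
Hypothesis p_sqfree : Zsqfree p.
Hypothesis r_sqfree : Zsqfree (5 * p).
Hypothesis p_mod4 : (exists k, p = 4 * k + 3)%Z.

(** Sending each representative of the first system to an associated one of the second is injective,
    as two sharing an image would be associated. *)
Lemma complete_reps_le (a b : nat) (f g : nat -> el) :
  complete_reps p a f -> complete_reps p b g -> (a <= b)%nat.
Proof.
  intros (F1&F2&_) (_&_&G3).
  destruct (finite_choice _ 0%nat (fun i k => (k < b)%nat /\ assoc p (f i) (g k)) a) as (h&Hh).
  { intros i Hi; apply G3, F1, Hi. }
  apply injection_le with h; [intros; now apply Hh|].
  intros i j Hi Hj E; destruct (Nat.eq_dec i j) as [|Hne]; [assumption|exfalso].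
  apply (F2 i j Hi Hj Hne).
  destruct (Hh i Hi) as [_ Ai], (Hh j Hj) as [_ Aj]; rewrite <- E in Aj.
  apply assoc_trans with (g (h i)); try assumption; now apply assoc_sym.
Qed.

Lemma iota_eq_unique (a : nat) (f : nat -> el) :
  complete_reps p a f -> forall b, iota_eq p b <-> b = a.
Proof.
  intros Hf b; split.
  - intros (g&Hg); apply Nat.le_antisymm; [apply complete_reps_le with g f
      |apply complete_reps_le with f g]; assumption.
  - intros ->; now exists f.
Qed.
End Counting.

(** * The sequences [x] and [y] *)

Lemma pow_P (k : nat) : phi ^ k = P (Z.of_nat k).
Proof. apply pow_powerRZ. Qed.

Lemma inA_pow (k : nat) : inA (phi ^ k) (psi ^ k).
Proof.
  induction k as [|k IH]; simpl; [apply (inA_IZR 1)|auto with ina].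
Qed.

Lemma sqrt5_coords (a b c d : Z) :
  IZR a + IZR b * sqrt 5 = IZR c + IZR d * sqrt 5 -> a = c /\ b = d.
Proof.
  intros H.
  assert (Hz : inA (IZR (a - c) + IZR (b - d) * sqrt 5) (IZR (a - c) + IZR (b - d) * - sqrt 5))
    by auto with ina.
  assert (E : IZR (a - c) + IZR (b - d) * sqrt 5 = 0) by (rewrite !minus_IZR; lra).
  assert (E' := inA_zero _ _ Hz E).
  assert (S := sqrt5_bounds).
  assert (Ea : IZR (a - c) = 0) by lra.
  assert (Eb : IZR (b - d) = 0) by nra.
  apply eq_IZR in Ea, Eb; lia.
Qed.

Section Sequences.
Variables x y : nat -> Z.
Hypothesis Hxy : forall m : nat, (IZR (x m) + IZR (y m) * sqrt 5) / 2 = ((1 + sqrt 5) / 2) ^ m.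

Lemma xy_phi (k : nat) : IZR (x k) + IZR (y k) * sqrt 5 = 2 * phi ^ k.
Proof. unfold phi; rewrite <- Hxy; field. Qed.

(** The hypothesis concerns one real place only. Writing phi^k = a + b phi and comparing
    coordinates, legitimate as sqrt 5 is irrational, transfers it to the conjugate. *)
Lemma xy_psi (k : nat) : IZR (x k) - IZR (y k) * sqrt 5 = 2 * psi ^ k.
Proof.
  destruct (inA_pow k) as (a&b&Ea&Eb); assert (H := xy_phi k); rewrite Ea in H.
  rewrite Eb; unfold phi in H; unfold psi.
  destruct (sqrt5_coords (x k) (y k) (2 * a + b) b) as [-> ->].
  - rewrite H, plus_IZR, mult_IZR; field.
  - rewrite plus_IZR, mult_IZR; field.
Qed.

Lemma psi_odd_pow (k : nat) : psi ^ (2 * k + 1) = - P (- Z.of_nat (2 * k + 1)).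
Proof.
  rewrite P_neg, <- pow_P, <- pow_inv, phi_inv, psi_phi.
  replace (1 - phi) with (-1 * (phi - 1)) by ring.
  rewrite Rpow_mult_distr, Nat.add_1_r, pow_1_odd; ring.
Qed.

Lemma xy_norm (k : nat) : (x (2 * k + 1) * x (2 * k + 1) = 5 * (y (2 * k + 1) * y (2 * k + 1)) - 4)%Z.
Proof.
  apply eq_IZR; rewrite minus_IZR, !mult_IZR.
  assert (H1 := xy_phi (2 * k + 1)); assert (H2 := xy_psi (2 * k + 1)).
  rewrite psi_odd_pow in H2; rewrite pow_P in H1.
  assert (PN := P_mul_neg (Z.of_nat (2 * k + 1))); assert (S := sqrt5_sq).
  assert (E : (IZR (x (2 * k + 1)) + IZR (y (2 * k + 1)) * sqrt 5) *
    (IZR (x (2 * k + 1)) - IZR (y (2 * k + 1)) * sqrt 5) = -4) by (rewrite H1, H2; lra).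
  replace (IZR (x (2 * k + 1)) * IZR (x (2 * k + 1))) with
    (5 * (IZR (y (2 * k + 1)) * IZR (y (2 * k + 1))) +
    (IZR (x (2 * k + 1)) + IZR (y (2 * k + 1)) * sqrt 5) *
    (IZR (x (2 * k + 1)) - IZR (y (2 * k + 1)) * sqrt 5)) by (ring [S]).
  rewrite E; simpl; ring.
Qed.

(* [phi ^ 12 = 161 + 72 sqrt 5] and [phi ^ 3 = 2 + sqrt 5]. *)
Lemma xy_12n3 (n : nat) : exists a b : Z,
  x (12 * n + 3) = (2 * a)%Z /\ y (12 * n + 3) = (2 * b)%Z /\ (2 <= a)%Z /\ (1 <= b)%Z /\
  (exists k, a = 5 * k + 2)%Z /\ (exists k, b = 2 * k + 1)%Z.
Proof.
  (* The halves of x and y are tracked: a = 2 modulo 5 yields X = -1 modulo 5, and Y = 2b yields p =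
     4 b^2 - 1, which is 3 modulo 4. *)
  assert (H : exists a b : Z, phi ^ (12 * n + 3) = IZR a + IZR b * sqrt 5 /\ (2 <= a)%Z /\ (1 <= b)%Z /\
    (exists k, a = 5 * k + 2)%Z /\ (exists k, b = 2 * k + 1)%Z).
  { induction n as [|n (a&b&E&Ha&Hb&(k&Hk)&(l&Hl))].
    - exists 2%Z, 1%Z; split; [|split; [lia|split; [lia|split; [exists 0%Z|exists 0%Z]; lia]]].
      rewrite sqrt5_phi; simpl; ring [phi_sq].
    - exists (161 * a + 360 * b)%Z, (72 * a + 161 * b)%Z.
      split; [|split; [lia|split; [lia|split]]].
      + replace (12 * S n + 3)%nat with (12 + (12 * n + 3))%nat by lia.
        rewrite pow_add, E, !plus_IZR, !mult_IZR.
        assert (E12 : phi ^ 12 = 161 + 72 * sqrt 5).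
        { assert (E3 : phi ^ 3 = 2 + sqrt 5) by (rewrite sqrt5_phi; simpl; ring [phi_sq]).
          change 12%nat with (3 * 4)%nat; rewrite pow_mult, E3; ring [sqrt5_sq]. }
        rewrite E12; ring [sqrt5_sq].
      + exists (32 * a + 72 * b + k)%Z; lia.
      + exists (36 * a + 80 * b + l)%Z; lia. }
  destruct H as (a&b&E&Ha&Hb&Hk&Hl).
  assert (Hx := xy_phi (12 * n + 3)); rewrite E in Hx.
  destruct (sqrt5_coords (x (12 * n + 3)) (y (12 * n + 3)) (2 * a) (2 * b)) as [E1 E2].
  { rewrite Hx, !mult_IZR; ring. }
  exists a, b; auto 10.
Qed.
End Sequences.

(** * The listed representatives and the count *)

Theorem theorem4p1 (x y : nat -> Z) (n : nat)
  (Hxy : forall m : nat, (IZR (x m) + IZR (y m) * sqrt 5) / 2 = ((1 + sqrt 5) / 2) ^ m)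
  (Hp : Zsqfree (y (12 * n + 3)%nat ^ 2 - 1)%Z)
  (Hr : Zsqfree (x (12 * n + 3)%nat ^ 2 - 1)%Z) :
  let X := x (12 * n + 3)%nat in
  let Y := y (12 * n + 3)%nat in
  let p := (Y ^ 2 - 1)%Z in
  let rho := El ((IZR X + IZR Y) / 2) 0 (- 1 / 2) (1 / 2) in
  let gamma (j : nat) :=
    El ((IZR (y (2 * j - 1)%nat) * IZR X + 1) / 2)
       ((IZR (x (2 * j - 1)%nat) * IZR X - (-1) ^ j) / 10)
       ((-1) ^ j * IZR (x (2 * j - 1)%nat) / 2)
       ((-1) ^ j * IZR (y (2 * j - 1)%nat) / 2) in
  let reps (k : nat) := match k with 0%nat => el1 | 1%nat => rho | S (S k') => gamma (S k') end in
  let w := ln ((1 + sqrt 5) / 2) in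
  complete_reps p (6 * n + 3) reps /\
  (forall m : nat, iota_eq p m <-> m = (6 * n + 3)%nat) /\
  (forall D : R, disc_eq p D ->
     ln D / (8 * w) <= INR (6 * n + 3) <= ln D / (8 * w) + 1).
Proof.
  intros X Y p rho gamma reps w.
  destruct (xy_12n3 x y Hxy n) as (a&b&EX&EY&Ha&Hb&(ka&Hka)&(kb&Hkb)).
  fold X in EX; fold Y in EY.
  assert (Hnorm : (X * X = 5 * (Y * Y) - 4)%Z).
  { unfold X, Y; replace (12 * n + 3)%nat with (2 * (6 * n + 1) + 1)%nat by lia.
    now apply xy_norm. }
  assert (Ep : (p = Y * Y - 1)%Z) by (unfold p; ring).
  assert (HXY : IZR X + IZR Y * sqrt 5 = 2 * P (12 * Z.of_nat n + 3)).
  { unfold X, Y; rewrite (xy_phi x y Hxy), pow_P; do 2 f_equal; lia. }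
  assert (HX5 : (exists k, X + 1 = 5 * k)%Z) by (exists (2 * ka + 1)%Z; lia).
  assert (HX4 : (4 <= X)%Z) by lia.
  assert (HY2 : (2 <= Y)%Z) by lia.
  assert (r_sqfree : Zsqfree (5 * p)).
  { replace (5 * p)%Z with (X ^ 2 - 1)%Z by (rewrite Ep; lia); exact Hr. }
  assert (p_mod4 : (exists k, p = 4 * k + 3)%Z).
  { exists (b * b - 1)%Z; rewrite Ep, EY; ring. }
  assert (p_pos : (0 < p)%Z) by (rewrite Ep; nia).
  change (Zsqfree p) in Hp.
  clearbody p; clear Hr a b ka kb EX EY Ha Hb Hka Hkb.
  set (N := (3 * Z.of_nat n)%Z).
  (* Position of the index [i] of [delta i] in the given list of representatives. *)
  set (pos := fun (k : nat) (i : Z) =>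
    (k = 1%nat /\ i = - (N + 1))%Z \/ (1 <= i /\ Z.of_nat k = 2 * i + 1)%Z
    \/ (i <= 0 /\ Z.of_nat k = 2 - 2 * i)%Z).
  assert (Hxy1 : forall j : nat, (1 <= j)%nat ->
    IZR (x (2 * j - 1)%nat) + IZR (y (2 * j - 1)%nat) * sqrt 5 = 2 * P (2 * Z.of_nat j - 1)).
  { intros j Hj; rewrite (xy_phi x y Hxy), pow_P; do 2 f_equal; lia. }
  assert (Hxy2 : forall j : nat, (1 <= j)%nat ->
    IZR (x (2 * j - 1)%nat) - IZR (y (2 * j - 1)%nat) * sqrt 5 = - 2 * P (- (2 * Z.of_nat j - 1))).
  { intros j Hj; rewrite (xy_psi x y Hxy).
    replace (2 * j - 1)%nat with (2 * (j - 1) + 1)%nat by lia.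
    rewrite psi_odd_pow; replace (Z.of_nat (2 * (j - 1) + 1)) with (2 * Z.of_nat j - 1)%Z by lia; ring. }
  assert (Hpos : forall k, (1 <= k < 6 * n + 3)%nat -> exists i, pos k i).
  (* For k >= 2 the entry is gamma_(k-1), so the parity of k - 1 decides the sign of the index; k =
     1 falls in the even case but holds rho. *)
  { intros k Hk; destruct (even_cases (Z.of_nat k - 1)) as (i&[Hi|Hi]).
    - destruct (Nat.eq_dec k 1) as [->|]; [exists (- (N + 1))%Z; now left|].
      exists i; right; left; lia.
    - exists (- i)%Z; right; right; lia. }
  assert (Hassoc : forall k i, (1 <= k < 6 * n + 3)%nat -> pos k i ->
    assoc p (reps k) (delta X i) /\ (- (N + 1) <= i <= N)%Z).
  { intros k i Hk [[-> ->]|[[Hi Hki]|[Hi Hki]]].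
    - split; [|lia].
      exists (el_phi (6 * Z.of_nat n + 2)); split; [now apply tp_unit_phi with (X := X) (Y := Y)|].
      apply (rho_delta n X Y p); assumption.
    - split; [|lia].
      replace (reps k) with (delta X i); [now apply assoc_refl|].
      destruct k as [|[|k]]; [lia|lia|]; unfold reps, gamma; symmetry.
      replace ((-1) ^ S k) with 1.
      + apply (gamma_even X (Z.of_nat (S k))); [apply Hxy1; lia|apply Hxy2; lia|lia].
      + replace (S k) with (2 * Z.to_nat i)%nat by lia; symmetry; apply pow_1_even.
    - split; [|lia].
      apply assoc_trans with (elconj true false (delta X (- i))); try assumption.
      + exists (el_phi 1); split; [now apply tp_unit_phi with (X := X) (Y := Y)|].
        destruct k as [|[|k]]; [lia|lia|]; unfold reps, gamma.
        replace ((-1) ^ S k) with (-1).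
        * apply (gamma_odd X p (Z.of_nat (S k))); [apply Hxy1; lia|apply Hxy2; lia|lia].
        * replace (S k) with (S (2 * Z.to_nat (- i)))%nat by lia; symmetry; apply pow_1_odd.
      + apply assoc_sym; try assumption.
        rewrite <- (Z.opp_involutive i) at 1.
        now apply delta_neg_assoc with (Y := Y). }
  assert (HC : complete_reps p (6 * n + 3) reps).
  { split; [|split].
    - intros k Hk; destruct k as [|k]; [now apply indec_one|].
      destruct (Hpos (S k)) as (i&Hi); [lia|].
      destruct (Hassoc (S k) i) as [HA HR]; [lia|assumption|].
      apply indec_assoc with (delta X i); try assumption.
      apply (indec_delta n X Y p); try assumption; lia.
    - assert (H1 : forall k, (k < 6 * n + 3)%nat -> (0 < k)%nat -> ~ assoc p el1 (reps k)).
      { intros k Hk Hk0 H; destruct (Hpos k) as (i&Hi); [lia|].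
        destruct (Hassoc k i) as [HA HR]; [lia|assumption|].
        apply (one_not_assoc_delta X Y p) with (i := i); try assumption.
        now apply assoc_trans with (reps k). }
      intros k l Hk Hl Hkl H.
      destruct k as [|k]; [apply (H1 l Hl); [lia|exact H]|].
      destruct l as [|l]; [apply (H1 (S k) Hk); [lia|now apply assoc_sym]|].
      destruct (Hpos (S k)) as (i&Hi); [lia|].
      destruct (Hpos (S l)) as (j&Hj); [lia|].
      destruct (Hassoc (S k) i) as [HA HR]; [lia|assumption|].
      destruct (Hassoc (S l) j) as [HB HS]; [lia|assumption|].
      assert (E : i = j).
      { apply (delta_assoc_inj n X Y p); try assumption.
        apply assoc_trans with (reps (S k)); try assumption; [now apply assoc_sym|].
        now apply assoc_trans with (reps (S l)). }
      subst j; destruct Hi as [Hi|[Hi|Hi]], Hj as [Hj|[Hj|Hj]]; lia.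
    - intros a Ha.
      destruct (indec_cases n X Y p HXY Hnorm Ep HX5 HX4 HY2 Hp r_sqfree p_mod4 a Ha) as [H|(i&H)].
      { exists 0%nat; split; [lia|exact H]. }
      assert (Hi : (Z.abs i <= N + 1)%Z).
      { apply (indec_delta_range n X Y p); try assumption.
        apply indec_assoc with a; try assumption; now apply assoc_sym. }
      (* The index N + 1 is absent from the list and is traded for -(N + 1), the index of rho. *)
      assert (Hi' : exists i', (- (N + 1) <= i' <= N)%Z /\ assoc p a (delta X i')).
      { destruct (Z.eq_dec i (N + 1)) as [->|]; [|exists i; split; [lia|assumption]].
        exists (- (N + 1))%Z; split; [lia|].
        apply assoc_trans with (delta X (N + 1)); try assumption.
        apply (delta_ends_assoc n X Y p); assumption. }
      destruct Hi' as (j&Hj&HA).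
      assert (Hk : exists k, (1 <= k < 6 * n + 3)%nat /\ pos k j).
      { destruct (Z.eq_dec j (- (N + 1))) as [->|]; [exists 1%nat; split; [lia|now left]|].
        destruct (Z_le_gt_dec 1 j).
        - exists (Z.to_nat (2 * j + 1)); split; [lia|right; left; lia].
        - exists (Z.to_nat (2 - 2 * j)); split; [lia|right; right; lia]. }
      destruct Hk as (k&Hk&Hkj); exists k; split; [lia|].
      apply assoc_trans with (delta X j); try assumption; apply assoc_sym; try assumption.
      now apply Hassoc. }
  split; [assumption|]; split; [now apply iota_eq_unique with reps|].
  intros D HD; apply disc_value in HD; try assumption; subst D.
  now apply (disc_bounds n X Y p).
Qed.
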